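(* Let $d>0$, $\mu_0>0$, $G>0$, and let $\rho:[0,\mu_0]\to(0,\infty)$ be continuous or piecewise constant (finitely many layers). Consider the body bounded by the oblate spheroid $\mu=\mu_0$ with confocal density stratification $\rho=\rho(\mu)$. Its gravitational potential has the form $$U=\frac{k}{2}\left(\frac12\,\frac{r^2\,\widetilde u(\mu)}{1+\mu^2}+d^2\,\widetilde v(\mu)\right),\qquad k=4\pi G,$$ where for internal points ($\mu\le\mu_0$) $$\widetilde u(\mu)=I_0(\mu)\big((1+3\mu^2)\operatorname{arccot}\mu-3\mu\big)-I_1(\mu)(1+3\mu^2),$$ $$\widetilde v(\mu)=-I_0(\mu)\big((1+\mu^2)\operatorname{arccot}\mu-\mu\big)+I_1(\mu)(1+\mu^2)+2I_2(\mu),$$ with $$I_0(\mu)=\int_0^{\mu}\rho(\xi)(1+3\xi^2)\,d\xi,\quad I_1(\mu)=\int_{\mu_0}^{\mu}\rho(\xi)\big((1+3\xi^2)\operatorname{arccot}\xi-3\xi\big)\,d\xi,\quad I_2(\mu)=\int_{\mu_0}^{\mu}\xi\rho(\xi)\,d\xi,$$ and for external points ($\mu>\mu_0$) $$\widetilde u(\mu)=I_0(\mu_0)\big((1+3\mu^2)\operatorname{arccot}\mu-3\mu\big),\qquad \widetilde v(\mu)=I_0(\mu_0)\big(\mu-(1+\mu^2)\operatorname{arccot}\mu\big).$$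
   Context: In $\mathbb R^3$ put $r^2=x^2+y^2$. The confocal oblate spheroids with focal distance $d$ are the surfaces $$\frac{r^2}{d^2(1+\mu^2)}+\frac{z^2}{d^2\mu^2}=1,\qquad \mu>0,$$ degenerating for $\mu\to0$ to the disc $z=0$, $r\le d$; every point of $\mathbb R^3$ off this disc lies on exactly one of them, which defines $\mu$ as a function on $\mathbb R^3$ (with $\mu=0$ on the disc). The body is $\{\mu\le\mu_0\}$, and its density at a point is $\rho(\mu)$. The function $\operatorname{arccot}$ takes values in $(0,\pi/2]$ on $[0,\infty)$. The gravitational potential $U$ is the $C^1$ function on $\mathbb R^3$ vanishing at infinity with $\Delta U=4\pi G\rho$, where $\rho$ is extended by $0$ outside the body (for discontinuous $\rho$ the equation holds away from the discontinuity surfaces); $G$ is the gravitational constant. *)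

(* Defs.v *)
From Stdlib Require Import Reals Lra Classical.
From Coquelicot Require Import Coquelicot.
Open Scope R_scope.

Definition arccot (x : R) : R := PI / 2 - atan x.

Lemma arccot_bounds (x : R) : 0 <= x -> 0 < arccot x <= PI / 2.
Proof.
  intros Hx. unfold arccot. destruct (atan_bound x) as [_ H].
  assert (0 <= atan x).
  { destruct Hx as [Hx | <-]; [|rewrite atan_0; lra].
    rewrite <- atan_0. apply Rlt_le, atan_increasing, Hx. }
  lra.
Qed.

Lemma cot_arccot (x : R) : cos (arccot x) / sin (arccot x) = x.
Proof.
  unfold arccot. rewrite cos_shift, sin_shift. apply tan_atan.
Qed.

(** A point of space is a triple [(x, y, z) : R * R * R], i.e. [((x, y), z)]. *)

Definition rsq (p : R * R * R) : R := let '(x, y, _) := p in x ^ 2 + y ^ 2.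
Definition zcoord (p : R * R * R) : R := snd p.

Definition on_spheroid (d m : R) (p : R * R * R) : Prop :=
  rsq p / (d ^ 2 * (1 + m ^ 2)) + zcoord p ^ 2 / (d ^ 2 * m ^ 2) = 1.

Definition on_focal_disc (d : R) (p : R * R * R) : Prop :=
  zcoord p = 0 /\ sqrt (rsq p) <= d.

(** [m] is the spheroidal coordinate of [p]; by [spheroidal_ex_unique] below it
    exists and is unique for every [p]. *)
Definition spheroidal (d : R) (p : R * R * R) (m : R) : Prop :=
  (on_focal_disc d p /\ m = 0) \/
  (~ on_focal_disc d p /\ 0 < m /\ on_spheroid d m p).

Definition is_spheroidal_coordinate (d : R) (mu : R * R * R -> R) : Prop :=
  forall p, spheroidal d p (mu p).

Lemma rsq_ge0 p : 0 <= rsq p.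
Proof. destruct p as [[x y] z]; simpl; nra. Qed.

Lemma on_focal_disc_iff d p :
  0 < d -> on_focal_disc d p <-> zcoord p = 0 /\ rsq p <= d ^ 2.
Proof.
  intros Hd. unfold on_focal_disc. pose proof (rsq_ge0 p) as Hr.
  assert (E : sqrt (d ^ 2) = d) by (apply sqrt_pow2; lra).
  split; intros [Hz H]; split; trivial.
  - apply sqrt_le_0; trivial; [nra | now rewrite E].
  - rewrite <- E. now apply sqrt_le_1_alt.
Qed.

Lemma on_spheroid_iff d m p :
  0 < d -> 0 < m ->
  on_spheroid d m p <->
  rsq p * m ^ 2 + zcoord p ^ 2 * (1 + m ^ 2) = d ^ 2 * m ^ 2 * (1 + m ^ 2).
Proof.
  intros Hd Hm. unfold on_spheroid.
  set (a := rsq p). set (b := zcoord p ^ 2).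
  assert (Hden : 0 < d ^ 2 * m ^ 2 * (1 + m ^ 2)).
  { apply Rmult_lt_0_compat; [apply Rmult_lt_0_compat|]; nra. }
  assert (E : a / (d ^ 2 * (1 + m ^ 2)) + b / (d ^ 2 * m ^ 2) =
              (a * m ^ 2 + b * (1 + m ^ 2)) / (d ^ 2 * m ^ 2 * (1 + m ^ 2))).
  { field. repeat split; nra. }
  rewrite E. split; intros H.
  - apply (f_equal (fun t => t * (d ^ 2 * m ^ 2 * (1 + m ^ 2)))) in H.
    unfold Rdiv in H. rewrite Rmult_assoc, Rinv_l in H; lra.
  - rewrite H. apply Rinv_r. lra.
Qed.

Lemma spheroidal_ex_unique d p : 0 < d -> exists! m, spheroidal d p m.
Proof.
  intros Hd. unfold spheroidal.
  destruct (classic (on_focal_disc d p)) as [D | D].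
  { exists 0. split; [now left|]. intros m [[_ ->] | [H _]]; tauto. }
  assert (Ha := rsq_ge0 p).
  assert (Hnd : ~ (zcoord p = 0 /\ rsq p <= d ^ 2))
    by (now rewrite <- (on_focal_disc_iff d p Hd)).
  pose (a := rsq p). pose (z := zcoord p).
  pose (B := a + z ^ 2 - d ^ 2). pose (q := sqrt (B ^ 2 + 4 * d ^ 2 * z ^ 2)).
  assert (Hd2 : 0 < d ^ 2) by nra.
  assert (Hz2 : 0 <= z ^ 2) by nra.
  assert (Hq : q ^ 2 = B ^ 2 + 4 * d ^ 2 * z ^ 2) by (apply pow2_sqrt; nra).
  assert (Hq0 : 0 <= q) by apply sqrt_pos.
  assert (HBq : 0 < B + q).
  { destruct (Req_dec z 0) as [Hz | Hz].
    - assert (~ a <= d ^ 2) by tauto. unfold B in *. rewrite Hz in *. nra.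
    - assert (0 < z ^ 2) by nra. assert (0 < 4 * d ^ 2 * z ^ 2) by nra. nra. }
  pose (s := (B + q) / (2 * d ^ 2)).
  assert (Hs : 0 < s) by (apply Rdiv_lt_0_compat; lra).
  assert (Es : d ^ 2 * s ^ 2 - B * s - z ^ 2 = 0).
  { assert (F : 2 * d ^ 2 * s = B + q) by (unfold s; field; lra).
    assert (K : 4 * d ^ 2 * (d ^ 2 * s ^ 2 - B * s - z ^ 2) = 0).
    { replace (4 * d ^ 2 * (d ^ 2 * s ^ 2 - B * s - z ^ 2))
        with ((2 * d ^ 2 * s) ^ 2 - 2 * B * (2 * d ^ 2 * s) - 4 * d ^ 2 * z ^ 2) by ring.
      rewrite F. lra. }
    apply Rmult_integral in K. destruct K as [K | K]; [lra | exact K]. }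
  assert (Hm : 0 < sqrt s) by now apply sqrt_lt_R0.
  assert (Em : sqrt s ^ 2 = s) by (apply pow2_sqrt; lra).
  exists (sqrt s). split.
  - right. split; [trivial|]. split; [trivial|].
    apply on_spheroid_iff; trivial. rewrite Em. fold a z.
    unfold B in Es. lra.
  - intros m [[H _] | (_ & Hm0 & H)]; [tauto|].
    apply on_spheroid_iff in H; trivial. fold a z in H.
    assert (E : d ^ 2 * (m ^ 2) ^ 2 - B * m ^ 2 - z ^ 2 = 0) by (unfold B; lra).
    assert (Ht : 0 < m ^ 2) by nra.
    set (t := m ^ 2) in *.
    assert (G : (s - t) * (d ^ 2 * s * t + z ^ 2) = 0).
    { replace ((s - t) * (d ^ 2 * s * t + z ^ 2)) with
        ((d ^ 2 * s ^ 2 - B * s - z ^ 2) * t - (d ^ 2 * t ^ 2 - B * t - z ^ 2) * s)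
        by ring.
      rewrite Es, E. ring. }
    assert (0 < d ^ 2 * s * t) by (exact (Rmult_lt_0_compat _ _ (Rmult_lt_0_compat _ _ Hd2 Hs) Ht)).
    apply Rmult_integral in G. destruct G as [G | G]; [|lra].
    replace s with t by lra. unfold t. apply sqrt_pow2. lra.
Qed.

(** Only the values of [rho] on [[0, mu0]] matter.  [IsStepFun] asks for a finite
    subdivision with [rho] constant on each open interval; the values at the
    layer boundaries are free. *)
Definition admissible_density (mu0 : R) (rho : R -> R) : Prop :=
  (forall m, 0 <= m <= mu0 -> 0 < rho m) /\
  (continuous_on (fun m => 0 <= m <= mu0) rho \/ inhabited (IsStepFun rho 0 mu0)).

Definition density_field (mu0 : R) (rho : R -> R) (mu : R * R * R -> R)
  (p : R * R * R) : R :=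
  if Rle_dec (mu p) mu0 then rho (mu p) else 0.

Definition Dx (U : R * R * R -> R) (p : R * R * R) : R :=
  let '(x, y, z) := p in Derive (fun t => U (t, y, z)) x.
Definition Dy (U : R * R * R -> R) (p : R * R * R) : R :=
  let '(x, y, z) := p in Derive (fun t => U (x, t, z)) y.
Definition Dz (U : R * R * R -> R) (p : R * R * R) : R :=
  let '(x, y, z) := p in Derive (fun t => U (x, y, t)) z.

Definition is_C1 (U : R * R * R -> R) : Prop :=
  (forall x y z, ex_derive (fun t => U (t, y, z)) x /\
                 ex_derive (fun t => U (x, t, z)) y /\
                 ex_derive (fun t => U (x, y, t)) z) /\
  (forall p, continuous (Dx U) p /\ continuous (Dy U) p /\ continuous (Dz U) p).

Definition vanishes_at_infinity (U : R * R * R -> R) : Prop :=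
  forall eps, 0 < eps ->
  exists A, forall p, A < sqrt (rsq p + zcoord p ^ 2) -> Rabs (U p) < eps.

(** The Laplacian exists at [p] and equals [l]. *)
Definition is_laplacian (U : R * R * R -> R) (p : R * R * R) (l : R) : Prop :=
  let '(x, y, z) := p in
  exists a b c,
    is_derive_n (fun t => U (t, y, z)) 2 x a /\
    is_derive_n (fun t => U (x, t, z)) 2 y b /\
    is_derive_n (fun t => U (x, y, t)) 2 z c /\
    l = a + b + c.

(** The Poisson equation is required exactly at the points where the density
    field [f] is continuous, i.e. away from its discontinuity surfaces. *)
Definition is_gravitational_potential (G : R) (f U : R * R * R -> R) : Prop :=
  is_C1 U /\ vanishes_at_infinity U /\
  forall p, continuous f p -> is_laplacian U p (4 * PI * G * f p).

Definition I0 (rho : R -> R) (m : R) : R :=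
  RInt (fun xi => rho xi * (1 + 3 * xi ^ 2)) 0 m.
Definition I1 (mu0 : R) (rho : R -> R) (m : R) : R :=
  RInt (fun xi => rho xi * ((1 + 3 * xi ^ 2) * arccot xi - 3 * xi)) mu0 m.
Definition I2 (mu0 : R) (rho : R -> R) (m : R) : R :=
  RInt (fun xi => xi * rho xi) mu0 m.

Definition u_tilde (mu0 : R) (rho : R -> R) (m : R) : R :=
  if Rle_dec m mu0 then
    I0 rho m * ((1 + 3 * m ^ 2) * arccot m - 3 * m)
    - I1 mu0 rho m * (1 + 3 * m ^ 2)
  else
    I0 rho mu0 * ((1 + 3 * m ^ 2) * arccot m - 3 * m).

Definition v_tilde (mu0 : R) (rho : R -> R) (m : R) : R :=
  if Rle_dec m mu0 then
    - I0 rho m * ((1 + m ^ 2) * arccot m - m)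
    + I1 mu0 rho m * (1 + m ^ 2) + 2 * I2 mu0 rho m
  else
    I0 rho mu0 * (m - (1 + m ^ 2) * arccot m).

(* Main.v *)
Require Import Defs.
From Stdlib Require Import Reals Lra Lia List Classical ClassicalEpsilon.
From Stdlib Require Import FunctionalExtensionality.
From Coquelicot Require Import Coquelicot.
Open Scope R_scope.

(** With [P] the density extended by [0] beyond [mu0], both cases of [u_tilde] and
    [v_tilde] are the same expression in the integrals [I0], [I1], [I2] of [P]. In its
    derivative the terms containing [P] cancel, so [U0] has gradient
    [k * (x h(mu), y h(mu), z w(mu))], where [h] and [w] involve [I0] and [I1] only; this
    gives [C^1] even across density jumps, and one more differentiation gives Poisson's
    equation wherever [P] is continuous. On the focal disc, where [mu] is not
    differentiable, one uses [h(m) - h(0) = o(m^2)] and the limit of [w] at [0].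

    For uniqueness, the difference [W] of two potentials is [C^1], tends to [0] at infinity
    and is harmonic off finitely many spheroids and the plane [z = 0]. Adding to [W] a small
    multiple of a strictly subharmonic function with convex kinks along these surfaces, the
    symmetric second differences at an interior maximum would be at most [0], although they
    are positive both on the surfaces (because [W] is [C^1]) and off them (because the
    Laplacian of [W] is [0]). *)

(** * Real analysis *)

(** The equation [((1 + m^2) y')' = 6 y] is Legendre's equation of degree 2 at an imaginary
    argument. Its solutions are [1 + 3 m^2] and [(1 + 3 m^2) arccot m - 3 m], and [u_tilde] is
    variation of parameters in this pair with coefficients [I0] and [I1]; this is why the density
    drops out of its first derivative. The term [2 I2] achieves the same for [v_tilde].

    Space is handled one variable at a time: [mu] and the potential are functions of [a = r^2] and
    [b = z^2], and the derivatives of [mu] are rational in [mu] and the root [conf_q] of the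
    discriminant.

    Poisson's equation is demanded where the density field is continuous in space, while the
    calculus uses continuity of a one-variable profile; the first has to be shown to imply the
    second.

    In the uniqueness proof a spheroid is tested along the [z] direction, in which the kink of its
    barrier has strength proportional to [|z|]. This degenerates at the equator, so the plane
    [z = 0] gets a kink of its own, which also takes care of the focal disc. *)

Lemma continuous_Rplus {T : UniformSpace} (f g : T -> R) (x : T) :
  continuous f x -> continuous g x -> continuous (fun t => f t + g t) x.
Proof. apply (continuous_plus (V := R_NormedModule)). Qed.

Lemma continuous_Rminus {T : UniformSpace} (f g : T -> R) (x : T) :
  continuous f x -> continuous g x -> continuous (fun t => f t - g t) x.
Proof. apply (continuous_minus (V := R_NormedModule)). Qed.

Lemma continuous_Rmult {T : UniformSpace} (f g : T -> R) (x : T) :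
  continuous f x -> continuous g x -> continuous (fun t => f t * g t) x.
Proof. apply (continuous_mult (K := R_AbsRing)). Qed.

Lemma continuous_pow {T : UniformSpace} (f : T -> R) (x : T) (n : nat) :
  continuous f x -> continuous (fun t => f t ^ n) x.
Proof.
  intros H. induction n as [|n IH]; simpl; [apply continuous_const|].
  now apply continuous_Rmult.
Qed.

Lemma continuous_Rdiv {T : UniformSpace} (f g : T -> R) (x : T) :
  continuous f x -> continuous g x -> g x <> 0 -> continuous (fun t => f t / g t) x.
Proof.
  intros Hf Hg H. apply continuous_Rmult; trivial.
  now apply (continuous_comp g Rinv), continuous_Rinv.
Qed.

Lemma continuous_of_eps (f : R -> R) (x : R) :
  (forall eps, 0 < eps -> exists del, 0 < del /\
     forall y, Rabs (y - x) < del -> Rabs (f y - f x) < eps) ->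
  continuous f x.
Proof.
  intros H. apply filterlim_locally. intros eps.
  destruct (H eps (cond_pos eps)) as [del [Hd K]].
  exists (mkposreal del Hd). intros y Hy. apply K, Hy.
Qed.

Lemma continuous_to_eps (f : R -> R) (x : R) :
  continuous f x -> forall eps, 0 < eps -> exists del, 0 < del /\
     forall y, Rabs (y - x) < del -> Rabs (f y - f x) < eps.
Proof.
  intros H eps He.
  pose proof (proj1 (filterlim_locally f (f x)) H (mkposreal eps He)) as [del K].
  exists del. split; [apply cond_pos|]. intros y Hy. apply (K y Hy).
Qed.

(** Needed at the focal disc for [z] times the axial coefficient: the first factor vanishes there,
    and the second is merely bounded nearby. *)
Lemma continuous_vanishing_mult {T : UniformSpace} (f g : T -> R) (x : T) (C : R) :
  continuous f x -> f x = 0 -> locally x (fun t => Rabs (g t) <= C) ->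
  continuous (fun t => f t * g t) x.
Proof.
  intros Hf H0 Hg. apply filterlim_locally. intros eps.
  assert (HC : 0 < Rabs C + 1) by (pose proof (Rabs_pos C); lra).
  assert (He : 0 < eps / (Rabs C + 1)) by (apply Rdiv_lt_0_compat; [apply cond_pos | trivial]).
  pose proof (proj1 (filterlim_locally f (f x)) Hf (mkposreal _ He)) as Hf'.
  generalize (filter_and _ _ Hf' Hg). apply filter_imp. intros t [A B].
  change (Rabs (f t - f x) < eps / (Rabs C + 1)) in A.
  change (Rabs (f t * g t - f x * g x) < eps).
  rewrite H0, Rminus_0_r in A. rewrite H0, Rmult_0_l, Rminus_0_r, Rabs_mult.
  apply Rle_lt_trans with (Rabs (f t) * (Rabs C + 1)).
  - apply Rmult_le_compat_l; [apply Rabs_pos | pose proof (Rle_abs C); lra].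
  - apply Rmult_lt_compat_r with (r := Rabs C + 1) in A; trivial.
    replace (eps / (Rabs C + 1) * (Rabs C + 1)) with (pos eps) in A by (field; lra). exact A.
Qed.

Lemma continuous_pair {T U V : UniformSpace} (f : T -> U) (g : T -> V) (x : T) :
  continuous f x -> continuous g x -> continuous (fun t => (f t, g t)) x.
Proof.
  intros Hf Hg. apply filterlim_locally. intros eps.
  generalize (filter_and _ _ (proj1 (filterlim_locally f (f x)) Hf eps)
    (proj1 (filterlim_locally g (g x)) Hg eps)).
  apply filter_imp. intros t [A B]. now split.
Qed.

Lemma is_derive_of_eps (f : R -> R) (x l : R) :
  (forall eps, 0 < eps -> exists del, 0 < del /\
     forall h, Rabs h < del -> Rabs (f (x + h) - f x - l * h) <= eps * Rabs h) ->
  is_derive f x l.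
Proof.
  intros H. apply is_derive_Reals. intros eps He.
  destruct (H (eps / 2) ltac:(lra)) as [del [Hd K]].
  exists (mkposreal del Hd). intros h Hh Hlt.
  replace ((f (x + h) - f x) / h - l) with ((f (x + h) - f x - l * h) / h) by (field; trivial).
  assert (Hp : 0 < Rabs h) by now apply Rabs_pos_lt.
  unfold Rdiv. rewrite Rabs_mult, Rabs_inv.
  apply Rmult_lt_reg_r with (Rabs h); trivial.
  rewrite Rmult_assoc, Rinv_l, Rmult_1_r by lra.
  eapply Rle_lt_trans; [apply K, Hlt|]. nra.
Qed.

Lemma is_derive_to_eps (f : R -> R) (x l : R) :
  is_derive f x l -> forall eps, 0 < eps -> exists del, 0 < del /\
     forall h, Rabs h < del -> Rabs (f (x + h) - f x - l * h) <= eps * Rabs h.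
Proof.
  intros H eps He. apply is_derive_Reals in H.
  destruct (H eps He) as [[del Hd] K]. exists del. split; trivial.
  intros h Hh. destruct (Req_dec h 0) as [-> | Hn].
  - rewrite Rplus_0_r, Rmult_0_r, Rabs_R0. replace (f x - f x - 0) with 0 by ring.
    rewrite Rabs_R0; lra.
  - replace (f (x + h) - f x - l * h) with (((f (x + h) - f x) / h - l) * h) by (field; trivial).
    rewrite Rabs_mult. apply Rmult_le_compat_r; [apply Rabs_pos|].
    left. apply K; trivial.
Qed.

Lemma is_derive_cont (f : R -> R) (x l : R) : is_derive f x l -> continuous f x.
Proof. intros H. exact (ex_derive_continuous f x (ex_intro _ l H)). Qed.

(** Since [g x = 0], the difference quotient is [f (x + h)] times that of [g], so continuity of [f]
    suffices. Here [f] is typically an integral of a density that jumps at [x]. *)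
Lemma is_derive_mult_vanishing (f g : R -> R) (x l : R) :
  continuous f x -> is_derive g x l -> g x = 0 ->
  is_derive (fun t => f t * g t) x (f x * l).
Proof.
  intros Hf Hg H0. apply is_derive_of_eps. intros eps He.
  set (M := Rabs (f x) + 1). assert (HM : 1 <= M) by (unfold M; pose proof (Rabs_pos (f x)); lra).
  set (N := Rabs l + 1). assert (HN : 1 <= N) by (unfold N; pose proof (Rabs_pos l); lra).
  set (e1 := Rmin 1 (eps / (2 * N))).
  set (e2 := eps / (2 * M)).
  assert (He2 : 0 < e2) by (apply Rdiv_lt_0_compat; lra).
  assert (He1' : 0 < eps / (2 * N)) by (apply Rdiv_lt_0_compat; lra).
  assert (He1 : 0 < e1) by (apply Rmin_pos; lra).
  destruct (continuous_to_eps f x Hf e1 He1) as [d1 [Hd1 K1]].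
  destruct (is_derive_to_eps g x l Hg e2 He2) as [d2 [Hd2 K2]].
  exists (Rmin d1 d2). split; [now apply Rmin_pos|]. intros h Hh.
  assert (A1 : Rabs (f (x + h) - f x) < e1).
  { apply K1. replace (x + h - x) with h by ring. eapply Rlt_le_trans; [exact Hh|apply Rmin_l]. }
  assert (A2 := K2 h ltac:(eapply Rlt_le_trans; [exact Hh|apply Rmin_r])).
  rewrite H0 in *. rewrite Rminus_0_r in A2.
  replace (f (x + h) * g (x + h) - f x * 0 - f x * l * h) with
    (f (x + h) * (g (x + h) - l * h) + (f (x + h) - f x) * (l * h)) by ring.
  eapply Rle_trans; [apply Rabs_triang|]. rewrite !Rabs_mult.
  assert (B : Rabs (f (x + h)) <= M).
  { replace (f (x + h)) with ((f (x + h) - f x) + f x) by ring.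
    eapply Rle_trans; [apply Rabs_triang|]. unfold M.
    assert (e1 <= 1) by apply Rmin_l. lra. }
  assert (C : e1 <= eps / (2 * N)) by apply Rmin_r.
  assert (Hh0 := Rabs_pos h). assert (Hl0 := Rabs_pos l).
  assert (D1 : Rabs (f (x + h)) * Rabs (g (x + h) - l * h) <= M * (e2 * Rabs h)).
  { apply Rmult_le_compat; trivial; apply Rabs_pos. }
  assert (D2 : Rabs (f (x + h) - f x) * (Rabs l * Rabs h) <= eps / (2 * N) * (N * Rabs h)).
  { apply Rmult_le_compat; [apply Rabs_pos|nra|lra|]. apply Rmult_le_compat_r; trivial. unfold N; lra. }
  replace (M * (e2 * Rabs h)) with (eps / 2 * Rabs h) in D1 by (unfold e2; field; lra).
  replace (eps / (2 * N) * (N * Rabs h)) with (eps / 2 * Rabs h) in D2 by (field; lra).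
  lra.
Qed.

(** By the mean value theorem the difference quotient at [x] is a nearby value of [g]. It carries
    derivative formulas across the focal disc and its rim, where the chain rule through [mu]
    fails. *)
Lemma is_derive_removable (f g : R -> R) (x : R) (del : R) :
  0 < del -> continuous f x -> continuous g x ->
  (forall y, y <> x -> Rabs (y - x) < del -> is_derive f y (g y)) ->
  is_derive f x (g x).
Proof.
  intros Hdel Hf Hg H. apply is_derive_of_eps. intros eps He.
  destruct (continuous_to_eps g x Hg eps He) as [d1 [Hd1 K1]].
  exists (Rmin del d1). split; [now apply Rmin_pos|]. intros h Hh.
  assert (Hh1 : Rabs h < del) by (eapply Rlt_le_trans; [exact Hh|apply Rmin_l]).
  assert (Hh2 : Rabs h < d1) by (eapply Rlt_le_trans; [exact Hh|apply Rmin_r]).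
  assert (Hin : forall y, Rmin x (x + h) <= y <= Rmax x (x + h) -> Rabs (y - x) <= Rabs h).
  { intros y. unfold Rmin, Rmax. destruct (Rle_dec x (x + h)); intros [A B];
    unfold Rabs; destruct (Rcase_abs (y - x)), (Rcase_abs h); lra. }
  destruct (MVT_gen f x (x + h) g) as [c [Hc E]].
  - intros y Hy. apply H.
    + intros ->. revert Hy. unfold Rmin, Rmax. destruct (Rle_dec x (x + h)); lra.
    + eapply Rle_lt_trans; [apply Hin; lra | trivial].
  - intros y Hy. apply continuity_pt_filterlim. destruct (Req_dec y x) as [-> | Hn]; trivial.
    apply (is_derive_cont f y (g y)), H; trivial. eapply Rle_lt_trans; [apply Hin; lra | trivial].
  - rewrite E. replace (g c * (x + h - x) - g x * h) with ((g c - g x) * h) by ring.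
    rewrite Rabs_mult. apply Rmult_le_compat_r; [apply Rabs_pos|]. left. apply K1.
    eapply Rle_lt_trans; [apply Hin, Hc | trivial].
Qed.

Lemma is_derive_Rplus (f g : R -> R) (x lf lg : R) :
  is_derive f x lf -> is_derive g x lg -> is_derive (fun t => f t + g t) x (lf + lg).
Proof. apply (is_derive_plus (V := R_NormedModule)). Qed.

Lemma is_derive_Rmult (f g : R -> R) (x lf lg : R) :
  is_derive f x lf -> is_derive g x lg ->
  is_derive (fun t => f t * g t) x (lf * g x + f x * lg).
Proof. intros H K. apply (is_derive_mult f g x lf lg H K). intros; apply Rmult_comm. Qed.

Lemma is_derive_Rcomp (f g : R -> R) (x lf lg : R) :
  is_derive f (g x) lf -> is_derive g x lg -> is_derive (fun t => f (g t)) x (lg * lf).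
Proof. apply (is_derive_comp (V := R_NormedModule)). Qed.

Lemma is_derive_arccot (x : R) : is_derive arccot x (- / (1 + x ^ 2)).
Proof.
  unfold arccot. auto_derive; trivial. unfold Rsqr. field. nra.
Qed.

Lemma arccot_continuous (x : R) : continuous arccot x.
Proof. eapply is_derive_cont, is_derive_arccot. Qed.

(** Integrability is asked against every continuous factor, which covers the kernels of [I0], [I1],
    [I2] and the auxiliary ones at once; [phi = 1] gives integrability of [P], hence local
    boundedness. *)
Definition weight (P : R -> R) : Prop :=
  forall phi : R -> R, (forall x, continuous phi x) ->
  forall a b, ex_RInt (fun t => P t * phi t) a b.

Section WeightedIntegrals.
Variable P : R -> R.
Hypothesis HP : weight P.

Lemma density_locally_bounded (a b : R) :
  exists M, 0 < M /\ forall t, a <= t <= b -> Rabs (P t) <= M.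
Proof.
  assert (H : ex_RInt P a b).
  { apply ex_RInt_ext with (fun t => P t * 1); [intros; apply Rmult_1_r|].
    apply HP. intros; apply continuous_const. }
  destruct (ex_RInt_ub P a b H) as [M K]. exists (Rabs M + 1).
  split; [pose proof (Rabs_pos M); lra|]. intros t Ht.
  assert (E := K t ltac:(rewrite Rmin_left, Rmax_right; lra)).
  change (norm (P t)) with (Rabs (P t)) in E. pose proof (Rle_abs M). lra.
Qed.

Lemma continuous_weighted_RInt (phi : R -> R) (a x : R) :
  (forall x, continuous phi x) -> continuous (fun m => RInt (fun t => P t * phi t) a m) x.
Proof.
  intros H. apply continuous_RInt_1 with (f := fun t => P t * phi t) (a := a).
  apply filter_forall. intros z. apply (RInt_correct (V := R_CompleteNormedModule)), HP, H.
Qed.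

Lemma is_derive_weighted_RInt (phi : R -> R) (a x : R) :
  (forall x, continuous phi x) -> continuous P x ->
  is_derive (fun m => RInt (fun t => P t * phi t) a m) x (P x * phi x).
Proof.
  intros H Hx. apply (is_derive_RInt (fun t => P t * phi t)) with (a := a).
  - apply filter_forall. intros z. apply (RInt_correct (V := R_CompleteNormedModule)), HP, H.
  - apply (continuous_mult (K := R_AbsRing)); [exact Hx | apply H].
Qed.

(** Near a zero of [psi], local boundedness of [P] makes [P * psi] continuous even if [P] jumps, so
    the fundamental theorem of calculus applies at [x]. *)
Lemma is_derive_weighted_RInt_zero (psi : R -> R) (a x : R) :
  (forall x, continuous psi x) -> psi x = 0 ->
  is_derive (fun m => RInt (fun t => P t * psi t) a m) x 0.
Proof.
  intros H H0. replace 0 with (P x * psi x) by (rewrite H0; ring).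
  apply (is_derive_RInt (fun t => P t * psi t)) with (a := a).
  - apply filter_forall. intros z. apply (RInt_correct (V := R_CompleteNormedModule)), HP, H.
  - apply continuous_of_eps. intros eps He.
    destruct (density_locally_bounded (x - 1) (x + 1)) as [M [HM KM]].
    destruct (continuous_to_eps psi x (H x) (eps / M)) as [del [Hdel K]].
    { now apply Rdiv_lt_0_compat. }
    exists (Rmin 1 del). split; [apply Rmin_pos; lra|]. intros y Hy.
    assert (A : Rabs (y - x) < 1) by (eapply Rlt_le_trans; [exact Hy|apply Rmin_l]).
    specialize (K y ltac:(eapply Rlt_le_trans; [exact Hy|apply Rmin_r])).
    apply Rabs_def2 in A. specialize (KM y ltac:(lra)).
    rewrite H0 in *. rewrite Rmult_0_r, Rminus_0_r in *. rewrite Rabs_mult.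
    apply Rle_lt_trans with (M * Rabs (psi y)).
    { apply Rmult_le_compat_r; [apply Rabs_pos | trivial]. }
    apply Rmult_lt_compat_l with (r := M) in K; trivial.
    replace (M * (eps / M)) with eps in K by (field; lra). exact K.
Qed.

(** Differentiating the integrals contributes [P x * (sum of phi_i x * alpha_i x) = 0],
    so [P] need not be continuous at [x]. *)
Lemma is_derive_cancel (phi1 phi2 phi3 al1 al2 al3 : R -> R) (c1 c2 c3 x l1 l2 l3 : R) :
  (forall x, continuous phi1 x) -> (forall x, continuous phi2 x) ->
  (forall x, continuous phi3 x) ->
  is_derive al1 x l1 -> is_derive al2 x l2 -> is_derive al3 x l3 ->
  phi1 x * al1 x + phi2 x * al2 x + phi3 x * al3 x = 0 ->
  is_derive (fun m => RInt (fun t => P t * phi1 t) c1 m * al1 m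
                    + RInt (fun t => P t * phi2 t) c2 m * al2 m
                    + RInt (fun t => P t * phi3 t) c3 m * al3 m) x
    (RInt (fun t => P t * phi1 t) c1 x * l1 + RInt (fun t => P t * phi2 t) c2 x * l2
     + RInt (fun t => P t * phi3 t) c3 x * l3).
Proof.
  intros C1 C2 C3 D1 D2 D3 H0.
  (* [psi] freezes the outer factors at [x]; the last hypothesis says [psi x = 0]. *)
  set (psi := fun t => phi1 t * al1 x + phi2 t * al2 x + phi3 t * al3 x).
  assert (Cpsi : forall t, continuous psi t).
  { intros t. unfold psi.
    apply continuous_Rplus; [apply continuous_Rplus|]; apply continuous_Rmult; trivial;
    apply continuous_const. }
  set (F1 := fun m => RInt (fun t => P t * phi1 t) c1 m).
  set (F2 := fun m => RInt (fun t => P t * phi2 t) c2 m).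
  set (F3 := fun m => RInt (fun t => P t * phi3 t) c3 m).
  assert (S : forall (phi : R -> R) (c m : R), (forall x : R, continuous phi x) ->
     RInt (fun t => P t * phi t) c m =
     RInt (fun t => P t * phi t) c x + RInt (fun t => P t * phi t) x m).
  { intros phi c m Hphi. symmetry. apply (RInt_Chasles (fun t => P t * phi t)); now apply HP. }
  assert (T : forall m, RInt (fun t => P t * psi t) x m =
     RInt (fun t => P t * phi1 t) x m * al1 x + RInt (fun t => P t * phi2 t) x m * al2 x
     + RInt (fun t => P t * phi3 t) x m * al3 x).
  { intros m. unfold psi. apply is_RInt_unique.
    apply is_RInt_ext with (fun t => plus (plus (scal (al1 x) (P t * phi1 t))
        (scal (al2 x) (P t * phi2 t))) (scal (al3 x) (P t * phi3 t))).
    { intros t _. unfold plus, scal; simpl. unfold mult; simpl. ring. }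
    replace (RInt (fun t => P t * phi1 t) x m * al1 x + RInt (fun t => P t * phi2 t) x m * al2 x
     + RInt (fun t => P t * phi3 t) x m * al3 x) with
     (plus (plus (scal (al1 x) (RInt (fun t => P t * phi1 t) x m))
        (scal (al2 x) (RInt (fun t => P t * phi2 t) x m)))
        (scal (al3 x) (RInt (fun t => P t * phi3 t) x m)))
     by (unfold plus, scal; simpl; unfold mult; simpl; ring).
    apply (is_RInt_plus (V := R_NormedModule)); [apply (is_RInt_plus (V := R_NormedModule))|];
    apply (is_RInt_scal (V := R_NormedModule)), (RInt_correct (V := R_CompleteNormedModule)), HP;
    trivial. }
  (* Regrouping around [x]: a constant, the integral with frozen factors, whose derivative is [0],
     and three products of a continuous integral with an increment vanishing at [x]. *)
  apply is_derive_ext with (fun m =>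
    (F1 x * al1 x + F2 x * al2 x + F3 x * al3 x) + RInt (fun t => P t * psi t) x m
    + F1 m * (al1 m - al1 x) + F2 m * (al2 m - al2 x) + F3 m * (al3 m - al3 x)).
  { intros m. rewrite T. unfold F1, F2, F3. rewrite (S phi1 c1 m), (S phi2 c2 m), (S phi3 c3 m) by trivial.
    cbv beta. match goal with |- ?a = ?b => change (@eq R a b) end. ring. }
  assert (V : forall (phi al : R -> R) (c l : R), (forall x : R, continuous phi x) -> is_derive al x l ->
     is_derive (fun m => RInt (fun t => P t * phi t) c m * (al m - al x)) x
       (RInt (fun t => P t * phi t) c x * l)).
  { intros phi al c l Hphi Hal.
    apply (is_derive_mult_vanishing (fun m => RInt (fun t => P t * phi t) c m)).
    - now apply continuous_weighted_RInt.
    - replace l with (minus l 0) by (unfold minus, plus, opp; simpl; ring).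
      apply (is_derive_minus (V := R_NormedModule) al (fun _ => al x)); trivial.
      apply (is_derive_const (V := R_NormedModule)).
    - ring. }
  fold (F1 x) (F2 x) (F3 x).
  replace (F1 x * l1 + F2 x * l2 + F3 x * l3) with (0 + 0 + F1 x * l1 + F2 x * l2 + F3 x * l3) by ring.
  apply is_derive_Rplus; [|now apply V]. apply is_derive_Rplus; [|now apply V].
  apply is_derive_Rplus; [|now apply V].
  apply is_derive_Rplus; [apply (is_derive_const (V := R_NormedModule))|].
  apply is_derive_weighted_RInt_zero; trivial.
Qed.

End WeightedIntegrals.

(** * Radial and axial force coefficients *)

Ltac cont :=
  lazymatch goal with
  | |- continuous (fun _ => ?c) _ => apply continuous_const
  | |- continuous (fun t => t) _ => apply continuous_id
  | |- continuous (fun t => @?f t ^ ?n) _ => apply (continuous_pow f); cont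
  | |- continuous (fun t => @?f t + @?g t) _ => apply (continuous_Rplus f g); cont
  | |- continuous (fun t => @?f t - @?g t) _ => apply (continuous_Rminus f g); cont
  | |- continuous (fun t => @?f t * @?g t) _ => apply (continuous_Rmult f g); cont
  | |- continuous (fun t => arccot t) _ => apply arccot_continuous
  | |- continuous (fun t => @?f t / @?g t) _ => apply (continuous_Rdiv f g); cont
  | _ => try assumption
  end.

Definition upot (P : R -> R) (mu0 m : R) : R :=
  I0 P m * ((1 + 3 * m ^ 2) * arccot m - 3 * m) - I1 mu0 P m * (1 + 3 * m ^ 2).
Definition vpot (P : R -> R) (mu0 m : R) : R :=
  - I0 P m * ((1 + m ^ 2) * arccot m - m) + I1 mu0 P m * (1 + m ^ 2) + 2 * I2 mu0 P m.
(** The gradient of the potential is [k] times [(x * radial, y * radial, z * axial)]. *)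
Definition radial (P : R -> R) (mu0 m : R) : R :=
  1 / 2 * (I0 P m * (arccot m - m / (1 + m ^ 2)) - I1 mu0 P m).
Definition axial (P : R -> R) (mu0 m : R) : R :=
  (1 - m * arccot m) * (I0 P m / m) + I1 mu0 P m.

Lemma arccot_lipschitz (x y : R) : Rabs (arccot x - arccot y) <= Rabs (x - y).
Proof.
  destruct (MVT_gen arccot y x (fun t => - / (1 + t ^ 2))) as [c [_ E]].
  - intros t _. apply is_derive_arccot.
  - intros t _. apply continuity_pt_filterlim, arccot_continuous.
  - rewrite E, Rabs_mult, Rabs_Ropp, Rabs_inv, (Rabs_pos_eq (1 + c ^ 2)) by nra.
    assert (/ (1 + c ^ 2) <= 1) by (rewrite <- Rinv_1; apply Rinv_le_contravar; nra).
    pose proof (Rabs_pos (x - y)). nra.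
Qed.

Section Potentials.
Variables (P : R -> R) (mu0 : R).
Hypothesis HP : weight P.

Lemma I0_weight_continuous (x : R) : continuous (fun t => 1 + 3 * t ^ 2) x.
Proof. cont. Qed.

Lemma I1_weight_continuous (x : R) :
  continuous (fun t => (1 + 3 * t ^ 2) * arccot t - 3 * t) x.
Proof. cont. Qed.

Lemma I0_continuous (m : R) : continuous (I0 P) m.
Proof.
  apply (continuous_weighted_RInt P HP (fun t => 1 + 3 * t ^ 2)), I0_weight_continuous.
Qed.

Lemma I1_continuous (m : R) : continuous (I1 mu0 P) m.
Proof.
  apply (continuous_weighted_RInt P HP (fun t => (1 + 3 * t ^ 2) * arccot t - 3 * t)),
    I1_weight_continuous.
Qed.

Lemma is_derive_I0 (m : R) :
  continuous P m -> is_derive (I0 P) m (P m * (1 + 3 * m ^ 2)).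
Proof.
  apply (is_derive_weighted_RInt P HP (fun t => 1 + 3 * t ^ 2)), I0_weight_continuous.
Qed.

Lemma is_derive_I1 (m : R) : continuous P m ->
  is_derive (I1 mu0 P) m (P m * ((1 + 3 * m ^ 2) * arccot m - 3 * m)).
Proof.
  apply (is_derive_weighted_RInt P HP (fun t => (1 + 3 * t ^ 2) * arccot t - 3 * t)),
    I1_weight_continuous.
Qed.

Lemma I2_flip (m : R) : I2 mu0 P m = RInt (fun t => P t * t) mu0 m.
Proof. apply RInt_ext. intros; apply Rmult_comm. Qed.

(** The density terms are [P] times [phi1 * phi2 - phi2 * phi1], as in variation of parameters,
    where [phi1] and [phi2] are the kernels of [I0] and [I1]. *)
Lemma is_derive_upot (m : R) :
  is_derive (upot P mu0) m
    (I0 P m * (6 * m * arccot m - (1 + 3 * m ^ 2) / (1 + m ^ 2) - 3) - 6 * m * I1 mu0 P m).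
Proof.
  assert (Hm : 0 < 1 + m ^ 2) by nra.
  replace (I0 P m * (6 * m * arccot m - (1 + 3 * m ^ 2) / (1 + m ^ 2) - 3) - 6 * m * I1 mu0 P m)
    with (I0 P m * (6 * m * arccot m - (1 + 3 * m ^ 2) / (1 + m ^ 2) - 3)
          + I1 mu0 P m * (- (6 * m)) + RInt (fun t => P t * 0) 0 m * 0) by ring.
  (* The third summand is zero padding for the three-term shape of [is_derive_cancel]. *)
  apply is_derive_ext with (fun t =>
    I0 P t * ((1 + 3 * t ^ 2) * arccot t - 3 * t) + I1 mu0 P t * (- (1 + 3 * t ^ 2))
    + RInt (fun s => P s * 0) 0 t * 0).
  { intros t. unfold upot. simpl. ring. }
  apply (is_derive_cancel P HP (fun t => 1 + 3 * t ^ 2)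
    (fun t => (1 + 3 * t ^ 2) * arccot t - 3 * t) (fun _ => 0)
    (fun t => (1 + 3 * t ^ 2) * arccot t - 3 * t) (fun t => - (1 + 3 * t ^ 2)) (fun _ => 0)).
  - apply I0_weight_continuous.
  - apply I1_weight_continuous.
  - intros; apply continuous_const.
  - unfold arccot. auto_derive; trivial. unfold Rsqr. field. nra.
  - auto_derive; trivial. ring.
  - apply (is_derive_const (V := R_NormedModule)).
  - ring.
Qed.

(** The cancellation is the identity [(1 + 3 m^2) (m - (1 + m^2) arccot m) + ((1 + 3 m^2) arccot m -
    3 m) (1 + m^2) + 2 m = 0], whose last term comes from [2 I2]. *)
Lemma is_derive_vpot (m : R) :
  is_derive (vpot P mu0) m (2 * (1 - m * arccot m) * I0 P m + 2 * m * I1 mu0 P m).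
Proof.
  replace (2 * (1 - m * arccot m) * I0 P m + 2 * m * I1 mu0 P m)
    with (I0 P m * (2 * (1 - m * arccot m)) + I1 mu0 P m * (2 * m)
          + RInt (fun t => P t * t) mu0 m * 0) by ring.
  apply is_derive_ext with (fun t =>
    I0 P t * (t - (1 + t ^ 2) * arccot t) + I1 mu0 P t * (1 + t ^ 2)
    + RInt (fun s => P s * s) mu0 t * 2).
  { intros t. unfold vpot. rewrite I2_flip. simpl. ring. }
  apply (is_derive_cancel P HP (fun t => 1 + 3 * t ^ 2)
    (fun t => (1 + 3 * t ^ 2) * arccot t - 3 * t) (fun t => t)
    (fun t => t - (1 + t ^ 2) * arccot t) (fun t => 1 + t ^ 2) (fun _ => 2)).
  - apply I0_weight_continuous.
  - apply I1_weight_continuous.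
  - intros; apply continuous_id.
  - unfold arccot. auto_derive; trivial. unfold Rsqr. field. nra.
  - auto_derive; trivial. ring.
  - apply (is_derive_const (V := R_NormedModule)).
  - ring.
Qed.

Lemma is_derive_vpot_axial (m : R) :
  m <> 0 -> is_derive (vpot P mu0) m (2 * m * axial P mu0 m).
Proof.
  intros Hm. replace (2 * m * axial P mu0 m)
    with (2 * (1 - m * arccot m) * I0 P m + 2 * m * I1 mu0 P m)
    by (unfold axial; field; trivial).
  apply is_derive_vpot.
Qed.

(** The same factor [axial] as in the derivative of [vpot]: the derivative of the potential in [m]
    at fixed [a] is therefore [m * axial * (d^2 - a / (1 + m^2)^2)]. *)
Lemma is_derive_upot_axial (m : R) :
  m <> 0 -> is_derive (fun t => upot P mu0 t / (1 + t ^ 2)) m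
              (- 4 * m * axial P mu0 m / (1 + m ^ 2) ^ 2).
Proof.
  intros Hm. assert (0 < 1 + m ^ 2) by nra.
  assert (D : is_derive (fun t => / (1 + t ^ 2)) m (- (2 * m) / (1 + m ^ 2) ^ 2)).
  { auto_derive; [nra|]. field; nra. }
  replace (- 4 * m * axial P mu0 m / (1 + m ^ 2) ^ 2) with
    ((I0 P m * (6 * m * arccot m - (1 + 3 * m ^ 2) / (1 + m ^ 2) - 3) - 6 * m * I1 mu0 P m)
      * / (1 + m ^ 2) + upot P mu0 m * (- (2 * m) / (1 + m ^ 2) ^ 2))
    by (unfold axial, upot; field; split; [trivial|nra]).
  apply (is_derive_Rmult (upot P mu0) (fun t => / (1 + t ^ 2))); [apply is_derive_upot | exact D].
Qed.

Lemma radial_continuous (m : R) : continuous (radial P mu0) m.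
Proof.
  unfold radial. cont; [apply I0_continuous | nra | apply I1_continuous].
Qed.

Lemma axial_continuous (m : R) : m <> 0 -> continuous (axial P mu0) m.
Proof.
  intros Hm. unfold axial. cont; [apply I0_continuous | apply I1_continuous].
Qed.

Lemma is_derive_radial (m : R) : continuous P m ->
  is_derive (radial P mu0) m (P m * m / (1 + m ^ 2) - I0 P m / (1 + m ^ 2) ^ 2).
Proof.
  intros HPm. assert (0 < 1 + m ^ 2) by nra.
  assert (D : is_derive (fun t => arccot t - t / (1 + t ^ 2)) m (- 2 / (1 + m ^ 2) ^ 2)).
  { unfold arccot. auto_derive; [nra|]. unfold Rsqr. field. nra. }
  apply is_derive_ext with (fun t => 1 / 2 * (I0 P t * (arccot t - t / (1 + t ^ 2)) + (- 1) * I1 mu0 P t)).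
  { intros t. unfold radial. simpl. ring. }
  evar (l : R). replace (P m * m / (1 + m ^ 2) - I0 P m / (1 + m ^ 2) ^ 2) with l.
  - apply is_derive_Rmult; [apply (is_derive_const (V := R_NormedModule))|].
    apply is_derive_Rplus.
    + apply is_derive_Rmult; [apply is_derive_I0, HPm | exact D].
    + apply is_derive_Rmult; [apply (is_derive_const (V := R_NormedModule))|].
      apply is_derive_I1, HPm.
  - unfold l, zero; simpl. field. nra.
Qed.

Lemma is_derive_axial (m : R) : m <> 0 -> continuous P m ->
  is_derive (axial P mu0) m (P m / m - I0 P m / (m ^ 2 * (1 + m ^ 2))).
Proof.
  intros Hm HPm. assert (0 < 1 + m ^ 2) by nra.
  assert (D : is_derive (fun t => / t - arccot t) m (- / (m ^ 2 * (1 + m ^ 2)))).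
  { unfold arccot. auto_derive; [trivial|]. unfold Rsqr. field. split; trivial. nra. }
  apply is_derive_ext_loc with (fun t => I0 P t * (/ t - arccot t) + I1 mu0 P t).
  { assert (Ha : 0 < Rabs m) by now apply Rabs_pos_lt.
    exists (mkposreal _ Ha). intros t Ht. unfold axial.
    assert (Ht' : Rabs (t - m) < Rabs m) by exact Ht.
    assert (t <> 0). { intros ->. rewrite Rminus_0_l, Rabs_Ropp in Ht'. lra. }
    simpl. field. trivial. }
  evar (l : R). replace (P m / m - I0 P m / (m ^ 2 * (1 + m ^ 2))) with l.
  - apply is_derive_Rplus.
    + apply is_derive_Rmult; [apply is_derive_I0, HPm | exact D].
    + apply is_derive_I1, HPm.
  - unfold l. field. split; trivial. nra.
Qed.

Lemma axial_bounded : exists C, 0 < C /\ forall m, 0 <= m <= 1 -> Rabs (axial P mu0 m) <= C.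
Proof.
  destruct (density_locally_bounded P HP 0 1) as [M [HM KM]].
  assert (HI1 : exists N, forall t, Rmin 0 1 <= t <= Rmax 0 1 -> Rabs (I1 mu0 P t) <= N).
  { apply (ex_RInt_ub (I1 mu0 P)). apply (ex_RInt_continuous (V := R_CompleteNormedModule)).
    intros; apply I1_continuous. }
  destruct HI1 as [N KN]. rewrite Rmin_left, Rmax_right in KN by lra.
  assert (HN : 0 <= N) by (eapply Rle_trans; [apply Rabs_pos | apply (KN 0); lra]).
  (* [3] bounds [1 - m * arccot m], because [arccot m <= PI / 2 <= 2]; [4 * M] bounds [I0 P m / m],
     because [1 + 3 t^2 <= 4] on [[0, 1]]; [N] bounds [I1]. *)
  exists (3 * (4 * M) + N). split; [lra|]. intros m Hm. unfold axial.
  eapply Rle_trans; [apply Rabs_triang|]. apply Rplus_le_compat; [|apply KN; lra].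
  rewrite Rabs_mult. apply Rmult_le_compat; try apply Rabs_pos.
  - destruct (arccot_bounds m ltac:(lra)) as [B1 B2].
    pose proof PI_4. apply Rabs_le. nra.
  - destruct (Req_dec m 0) as [-> | Hm0].
    { unfold I0. rewrite RInt_point. unfold zero; simpl. unfold Rdiv.
      rewrite Rmult_0_l, Rabs_R0. lra. }
    unfold Rdiv. rewrite Rabs_mult, Rabs_inv, (Rabs_pos_eq m) by lra.
    apply Rmult_le_reg_r with m; [lra|]. rewrite Rmult_assoc, Rinv_l, Rmult_1_r by lra.
    replace (4 * M * m) with ((m - 0) * (4 * M)) by ring.
    apply abs_RInt_le_const; [lra| |].
    + apply (HP (fun t => 1 + 3 * t ^ 2)), I0_weight_continuous.
    + intros t Ht. rewrite Rabs_mult. rewrite (Rmult_comm 4).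
      apply Rmult_le_compat; try apply Rabs_pos; [apply KM; lra|].
      rewrite Rabs_pos_eq; nra.
Qed.

(** With the convention for division, [axial] takes the value [I1 mu0 P 0] at [0], which misses the
    limit [P 0] of [I0 P m / m]; the value at [0] is therefore corrected. *)
Lemma axial_limit_0 : continuous P 0 ->
  continuous (fun m => if Req_EM_T m 0 then P 0 + I1 mu0 P 0 else axial P mu0 m) 0.
Proof.
  intros HP0.
  apply continuous_ext with (fun m => (1 - m * arccot m) *
    (if Req_EM_T m 0 then P 0 else I0 P m / m) + I1 mu0 P m).
  { intros m. destruct (Req_EM_T m 0) as [-> | Hm]; [simpl; ring | reflexivity]. }
  cont; [|apply I1_continuous].
  apply continuous_of_eps. intros eps He.
  destruct (is_derive_to_eps _ _ _ (is_derive_I0 0 HP0) (eps / 2) ltac:(lra)) as [del [Hd K]].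
  exists del. split; trivial. intros y Hy. rewrite Rminus_0_r in Hy.
  destruct (Req_EM_T 0 0) as [_ | n]; [|now destruct n].
  destruct (Req_EM_T y 0) as [-> | Hn]; [rewrite Rminus_diag, Rabs_R0; trivial|].
  specialize (K y Hy). rewrite Rplus_0_l in K.
  replace (I0 P 0) with 0 in K by (unfold I0; now rewrite RInt_point).
  assert (0 < Rabs y) by now apply Rabs_pos_lt.
  replace (I0 P y / y - P 0) with ((I0 P y - 0 - P 0 * (1 + 3 * 0 ^ 2) * y) / y) by (field; trivial).
  unfold Rdiv at 1. rewrite Rabs_mult, Rabs_inv.
  apply Rmult_lt_reg_r with (Rabs y); trivial.
  rewrite Rmult_assoc, Rinv_l, Rmult_1_r by lra. nra.
Qed.

(** For constant density the radial coefficient is constant, so only the oscillation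
    of [P] around [P 0] contributes. *)
Lemma radial_near_0 : continuous P 0 -> forall eps, 0 < eps -> exists del, 0 < del /\
  forall m, 0 <= m < del -> Rabs (radial P mu0 m - radial P mu0 0) <= eps * m ^ 2.
Proof.
  intros HP0 eps He.
  (* The kernel [K] below satisfies [|K t| <= 11 m] on [[0, m]]: [4 m] from the Lipschitz bound on
     [arccot] and [7 m] from the remaining terms. *)
  destruct (continuous_to_eps P 0 HP0 (eps / 11) ltac:(lra)) as [del [Hd KP]].
  exists (Rmin 1 del). split; [apply Rmin_pos; lra|]. intros m [Hm0 Hm].
  assert (Hm1 : m < 1) by (eapply Rlt_le_trans; [exact Hm | apply Rmin_l]).
  assert (Hm2 : m < del) by (eapply Rlt_le_trans; [exact Hm | apply Rmin_r]).
  set (al := arccot m - m / (1 + m ^ 2)).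
  set (K := fun t => (1 + 3 * t ^ 2) * al - ((1 + 3 * t ^ 2) * arccot t - 3 * t)).
  assert (CK : forall t, continuous K t) by (intros t; unfold K; cont).
  assert (E1 : radial P mu0 m - radial P mu0 0 = 1 / 2 * RInt (fun t => P t * K t) 0 m).
  { unfold radial. fold al.
    replace (I0 P 0) with 0 by (unfold I0; now rewrite RInt_point).
    assert (F : RInt (fun t => P t * K t) 0 m = I0 P m * al - (I1 mu0 P m - I1 mu0 P 0)).
    { assert (G : I1 mu0 P m - I1 mu0 P 0 =
          RInt (fun t => P t * ((1 + 3 * t ^ 2) * arccot t - 3 * t)) 0 m).
      { unfold I1. rewrite <- (RInt_Chasles (fun t => P t * ((1 + 3 * t ^ 2) * arccot t - 3 * t)) mu0 0 m)
          by apply HP, I1_weight_continuous.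
        unfold plus; simpl. ring. }
      rewrite G. apply is_RInt_unique.
      apply is_RInt_ext with (fun t => minus (scal al (P t * (1 + 3 * t ^ 2)))
        (P t * ((1 + 3 * t ^ 2) * arccot t - 3 * t))).
      { intros t _. unfold K, minus, plus, opp, scal; simpl. unfold mult; simpl. ring. }
      rewrite (Rmult_comm (I0 P m)).
      apply (is_RInt_minus (V := R_NormedModule)); [apply (is_RInt_scal (V := R_NormedModule))|];
      apply (RInt_correct (V := R_CompleteNormedModule)), HP;
      [apply I0_weight_continuous | apply I1_weight_continuous]. }
    rewrite F. field. }
  assert (E2 : is_RInt K 0 m 0).
  (* [Q] is an antiderivative of [K] that vanishes at [0] and, by the choice of [al], also at [m].
     This is the case of constant density. *)
  { set (Q := fun t => (t + t ^ 3) * al - ((t + t ^ 3) * arccot t - t ^ 2)).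
    replace 0 with (minus (Q m) (Q 0)) at 2.
    - apply (is_RInt_derive (V := R_CompleteNormedModule) Q K).
      + intros t _. unfold Q, K, arccot. auto_derive; trivial. unfold Rsqr. field. nra.
      + intros t _. apply CK.
    - unfold minus, plus, opp, Q, al; simpl. field. nra. }
  assert (E3 : RInt (fun t => P t * K t) 0 m = RInt (fun t => (P t - P 0) * K t) 0 m).
  { symmetry. apply is_RInt_unique.
    apply is_RInt_ext with (fun t => minus (P t * K t) (scal (P 0) (K t))).
    { intros t _. unfold minus, plus, opp, scal; simpl. unfold mult; simpl. ring. }
    replace (RInt (fun t => P t * K t) 0 m) with
      (minus (RInt (fun t => P t * K t) 0 m) (scal (P 0) 0))
      by (unfold minus, plus, opp, scal; simpl; unfold mult; simpl; ring).
    apply (is_RInt_minus (V := R_NormedModule)).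
    - apply (RInt_correct (V := R_CompleteNormedModule)), HP, CK.
    - apply (is_RInt_scal (V := R_NormedModule)), E2. }
  assert (X3 : ex_RInt (fun t => (P t - P 0) * K t) 0 m).
  { apply ex_RInt_ext with (fun t => minus (P t * K t) (scal (P 0) (K t))).
    { intros t _. unfold minus, plus, opp, scal; simpl. unfold mult; simpl. ring. }
    apply (ex_RInt_minus (V := R_NormedModule)); [apply HP, CK|].
    apply (ex_RInt_scal (V := R_NormedModule)). exists 0. exact E2. }
  assert (E4 : Rabs (RInt (fun t => (P t - P 0) * K t) 0 m) <= (m - 0) * (eps / 11 * (11 * m))).
  { apply abs_RInt_le_const; trivial. intros t Ht. rewrite Rabs_mult.
    apply Rmult_le_compat; try apply Rabs_pos.
    { left. apply KP. rewrite Rminus_0_r, Rabs_pos_eq; lra. }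
    replace (K t) with ((1 + 3 * t ^ 2) * (arccot m - arccot t) + (3 * t - (1 + 3 * t ^ 2) * (m / (1 + m ^ 2))))
      by (unfold K, al; ring).
    assert (Ht2 : 0 <= t ^ 2 <= 1) by nra.
    assert (Hq : 0 <= m / (1 + m ^ 2) <= m).
    { assert (0 < / (1 + m ^ 2) <= 1).
      { split; [apply Rinv_0_lt_compat; nra|]. rewrite <- Rinv_1. apply Rinv_le_contravar; nra. }
      unfold Rdiv. nra. }
    eapply Rle_trans; [apply Rabs_triang|].
    replace (11 * m) with (4 * m + 7 * m) by ring. apply Rplus_le_compat.
    - rewrite Rabs_mult, (Rabs_pos_eq (1 + 3 * t ^ 2)) by lra.
      apply Rmult_le_compat; [lra | apply Rabs_pos | lra |].
      eapply Rle_trans; [apply arccot_lipschitz|]. rewrite Rabs_pos_eq; lra.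
    - set (q := m / (1 + m ^ 2)) in *.
      assert (0 <= (1 + 3 * t ^ 2) * q <= 4 * m) by (split; nra).
      apply Rabs_le. lra. }
  rewrite E1, E3, Rabs_mult, (Rabs_pos_eq (1 / 2)) by lra.
  replace ((m - 0) * (eps / 11 * (11 * m))) with (eps * m ^ 2) in E4 by field.
  pose proof (Rabs_pos (RInt (fun t => (P t - P 0) * K t) 0 m)). lra.
Qed.

End Potentials.

(** * The spheroidal coordinate as a function of [r^2] and [z^2] *)

(** In terms of [a = r^2] and [b = z^2], the square of the spheroidal coordinate is the
    nonnegative root [s] of [d^2 s^2 - (a + b - d^2) s - b = 0]; [conf_q] is the square
    root of the discriminant. *)
Definition conf_q (d a b : R) : R := sqrt ((a + b - d ^ 2) ^ 2 + 4 * d ^ 2 * b).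
Definition conf_s (d a b : R) : R := (a + b - d ^ 2 + conf_q d a b) / (2 * d ^ 2).
Definition conf_m (d a b : R) : R := sqrt (conf_s d a b).

(** The factor [k] is left out. The partial derivatives in [a] and [b] turn out to be [radial / 2]
    and [axial / 2], and the factors [2 x], [2 y], [2 z] of the chain rule absorb the halves. *)
Definition potential (d : R) (P : R -> R) (mu0 a b : R) : R :=
  1 / 2 * (1 / 2 * (a * upot P mu0 (conf_m d a b) / (1 + conf_m d a b ^ 2))
           + d ^ 2 * vpot P mu0 (conf_m d a b)).

Section Confocal.
Variable d : R.
Hypothesis Hd : 0 < d.

Lemma conf_q_eq (a b : R) : conf_q d a b = 2 * d ^ 2 * conf_s d a b - (a + b - d ^ 2).
Proof. unfold conf_s. field. nra. Qed.

Lemma conf_disc_ge (a b : R) : 0 <= b ->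
  (a + b - d ^ 2) ^ 2 <= (a + b - d ^ 2) ^ 2 + 4 * d ^ 2 * b.
Proof. intros Hb. assert (0 <= 4 * d ^ 2 * b) by (apply Rmult_le_pos; nra). lra. Qed.

Lemma conf_q_ge (a b : R) : 0 <= b -> Rabs (a + b - d ^ 2) <= conf_q d a b.
Proof.
  intros Hb. unfold conf_q. rewrite <- sqrt_Rsqr_abs. apply sqrt_le_1_alt.
  pose proof (conf_disc_ge a b Hb). unfold Rsqr. lra.
Qed.

Lemma conf_s_ge0 (a b : R) : 0 <= b -> 0 <= conf_s d a b.
Proof.
  intros Hb. pose proof (conf_q_ge a b Hb) as H. apply Rabs_le_between in H.
  unfold conf_s. apply Rdiv_le_0_compat; nra.
Qed.

Lemma conf_s_eq (a b : R) : 0 <= b ->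
  d ^ 2 * conf_s d a b ^ 2 = (a + b - d ^ 2) * conf_s d a b + b.
Proof.
  intros Hb.
  assert (Hq : conf_q d a b ^ 2 = (a + b - d ^ 2) ^ 2 + 4 * d ^ 2 * b).
  { apply pow2_sqrt. pose proof (conf_disc_ge a b Hb). pose proof (pow2_ge_0 (a + b - d ^ 2)). lra. }
  rewrite conf_q_eq in Hq.
  assert (Hd2 : 0 < d ^ 2) by nra.
  apply Rmult_eq_reg_l with (4 * d ^ 2); nra.
Qed.

(** The inequality puts [t] at or above the midpoint of the two roots of the quadratic, hence
    selects the larger one. *)
Lemma conf_s_unique (a b t : R) : 0 <= b ->
  d ^ 2 * t ^ 2 = (a + b - d ^ 2) * t + b -> a + b - d ^ 2 <= 2 * d ^ 2 * t ->
  conf_s d a b = t.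
Proof.
  intros Hb Ht Hle.
  assert (Hq : conf_q d a b = 2 * d ^ 2 * t - (a + b - d ^ 2)).
  { unfold conf_q. rewrite <- (sqrt_pow2 (2 * d ^ 2 * t - (a + b - d ^ 2))) by lra.
    f_equal. nra. }
  unfold conf_s. rewrite Hq. field. nra.
Qed.

Lemma conf_m_ge0 (a b : R) : 0 <= conf_m d a b.
Proof. apply sqrt_pos. Qed.

Lemma conf_m_sqr (a b : R) : 0 <= b -> conf_m d a b ^ 2 = conf_s d a b.
Proof. intros Hb. apply pow2_sqrt, conf_s_ge0, Hb. Qed.

Lemma conf_s_pos (a b : R) : 0 <= b -> 0 < b \/ d ^ 2 < a -> 0 < conf_s d a b.
Proof.
  intros Hb H. destruct (conf_s_ge0 a b Hb) as [E | E]; trivial.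
  pose proof (conf_s_eq a b Hb) as F. pose proof (conf_q_ge a b Hb) as K.
  pose proof (conf_q_eq a b) as Q. rewrite <- E in *.
  apply Rabs_le_between in K. nra.
Qed.

Lemma conf_m_pos (a b : R) : 0 <= b -> 0 < b \/ d ^ 2 < a -> 0 < conf_m d a b.
Proof. intros Hb H. now apply sqrt_lt_R0, conf_s_pos. Qed.

Lemma conf_m_disc (a : R) : a <= d ^ 2 -> conf_m d a 0 = 0.
Proof.
  intros H. unfold conf_m. rewrite (conf_s_unique a 0 0) by lra. apply sqrt_0.
Qed.

(** The quadratic equation gives [conf_q * s = d^2 s^2 + b] with [s = conf_s d a b]. *)
Lemma conf_q_pos (a b : R) : 0 <= b -> 0 < conf_s d a b -> 0 < conf_q d a b.
Proof.
  intros Hb H. pose proof (conf_s_eq a b Hb) as F. pose proof (conf_q_eq a b) as Q.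
  assert (0 < d ^ 2 * conf_s d a b ^ 2) by (apply Rmult_lt_0_compat; nra).
  apply Rmult_lt_reg_r with (conf_s d a b); trivial. rewrite Q. nra.
Qed.

Lemma spheroidal_conf_m (p : R * R * R) : spheroidal d p (conf_m d (rsq p) (zcoord p ^ 2)).
Proof.
  unfold spheroidal. rewrite on_focal_disc_iff by trivial.
  destruct (classic (zcoord p = 0 /\ rsq p <= d ^ 2)) as [[Hz Ha] | D].
  - left. split; [tauto|]. rewrite Hz. replace (0 ^ 2) with 0 by ring. now apply conf_m_disc.
  - right. split; trivial.
    assert (Hb : 0 <= zcoord p ^ 2) by nra.
    assert (Hm : 0 < conf_m d (rsq p) (zcoord p ^ 2)).
    { apply conf_m_pos; trivial. destruct (Req_dec (zcoord p) 0) as [Hz | Hz].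
      - right. apply Rnot_le_lt. tauto.
      - left. nra. }
    split; trivial. apply on_spheroid_iff; trivial.
    rewrite conf_m_sqr by trivial. pose proof (conf_s_eq (rsq p) (zcoord p ^ 2) Hb). lra.
Qed.

Lemma spheroidal_coordinate_eq (mu : R * R * R -> R) : is_spheroidal_coordinate d mu ->
  forall p, mu p = conf_m d (rsq p) (zcoord p ^ 2).
Proof.
  intros H p. destruct (spheroidal_ex_unique d p Hd) as [m [_ U]].
  rewrite <- (U _ (H p)). apply U, spheroidal_conf_m.
Qed.

Lemma conf_m_spheroid (a b m : R) : 0 <= b -> 0 < m ->
  a * m ^ 2 + b * (1 + m ^ 2) = d ^ 2 * m ^ 2 * (1 + m ^ 2) -> conf_m d a b = m.
Proof.
  intros Hb Hm H. unfold conf_m. rewrite (conf_s_unique a b (m ^ 2)); trivial.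
  - apply sqrt_pow2. lra.
  - lra.
  - assert (0 < d ^ 2 * m ^ 2) by (apply Rmult_lt_0_compat; nra).
    assert (0 < m ^ 2) by nra.
    apply Rmult_le_reg_r with (m ^ 2); nra.
Qed.

(** The derivative of the quadratic in [s] is [conf_q], so implicit differentiation gives
    [s / conf_q] in [a] and [(1 + s) / conf_q] in [b]; then [m = sqrt s]. *)
Lemma is_derive_conf_m_a (a b : R) : 0 <= b -> 0 < conf_s d a b ->
  is_derive (fun a => conf_m d a b) a (conf_m d a b / (2 * conf_q d a b)).
Proof.
  intros Hb Hs. pose proof (conf_q_pos a b Hb Hs) as Hq.
  assert (Hm : 0 < conf_m d a b) by now apply sqrt_lt_R0.
  pose proof (conf_m_sqr a b Hb) as Em. pose proof (conf_q_eq a b) as Q.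
  assert (Hr : 0 < (a + b - d ^ 2) ^ 2 + 4 * d ^ 2 * b).
  { apply Rnot_le_lt. intros C. unfold conf_q in Hq. rewrite sqrt_neg_0 in Hq; lra. }
  assert (Ds : is_derive (fun a => conf_s d a b) a (conf_s d a b / conf_q d a b)).
  { unfold conf_s. unfold conf_q at 1. auto_derive; [repeat split; trivial|].
    replace ((a + b + - (d * (d * 1))) * ((a + b + - (d * (d * 1))) * 1) + 4 * (d * (d * 1)) * b)
      with ((a + b - d ^ 2) ^ 2 + 4 * d ^ 2 * b) by ring.
    fold (conf_q d a b). field. split; nra. }
  replace (conf_m d a b / (2 * conf_q d a b))
    with (conf_s d a b / conf_q d a b / (2 * sqrt (conf_s d a b))).
  - apply (is_derive_sqrt (fun a => conf_s d a b)); trivial.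
  - fold (conf_m d a b). rewrite <- Em. field. split; lra.
Qed.

Lemma is_derive_conf_m_b (a b : R) : 0 <= b -> 0 < conf_s d a b ->
  is_derive (fun b => conf_m d a b) b
    ((1 + conf_m d a b ^ 2) / (2 * conf_m d a b * conf_q d a b)).
Proof.
  intros Hb Hs. pose proof (conf_q_pos a b Hb Hs) as Hq.
  assert (Hm : 0 < conf_m d a b) by now apply sqrt_lt_R0.
  pose proof (conf_m_sqr a b Hb) as Em. pose proof (conf_q_eq a b) as Q.
  assert (Hr : 0 < (a + b - d ^ 2) ^ 2 + 4 * d ^ 2 * b).
  { apply Rnot_le_lt. intros C. unfold conf_q in Hq. rewrite sqrt_neg_0 in Hq; lra. }
  assert (Ds : is_derive (fun b => conf_s d a b) b ((1 + conf_s d a b) / conf_q d a b)).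
  { unfold conf_s. unfold conf_q at 1. auto_derive; [repeat split; trivial|].
    replace ((a + b + - (d * (d * 1))) * ((a + b + - (d * (d * 1))) * 1) + 4 * (d * (d * 1)) * b)
      with ((a + b - d ^ 2) ^ 2 + 4 * d ^ 2 * b) by ring.
    fold (conf_q d a b). field. split; nra. }
  replace ((1 + conf_m d a b ^ 2) / (2 * conf_m d a b * conf_q d a b))
    with ((1 + conf_s d a b) / conf_q d a b / (2 * sqrt (conf_s d a b))).
  - apply (is_derive_sqrt (fun b => conf_s d a b)); trivial.
  - fold (conf_m d a b). rewrite <- Em. field. split; lra.
Qed.

Lemma conf_m_continuous {T : UniformSpace} (f g : T -> R) (x : T) :
  continuous f x -> continuous g x -> continuous (fun t => conf_m d (f t) (g t)) x.
Proof.
  intros Hf Hg. unfold conf_m.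
  apply (continuous_comp _ sqrt); [|apply continuous_sqrt].
  unfold conf_s. apply continuous_Rdiv; [|apply continuous_const|nra].
  cont. unfold conf_q. apply (continuous_comp _ sqrt); [|apply continuous_sqrt]. cont.
Qed.

Variables (P : R -> R) (mu0 : R).
Hypothesis HP : weight P.

Lemma potential_continuous (a b : R -> R) (x : R) :
  continuous a x -> continuous b x -> continuous (fun t => potential d P mu0 (a t) (b t)) x.
Proof.
  intros Ha Hb. unfold potential.
  assert (Hm := conf_m_continuous a b x Ha Hb).
  assert (Hv : continuous (fun t => vpot P mu0 (conf_m d (a t) (b t))) x).
  { apply (continuous_comp (fun t => conf_m d (a t) (b t))); trivial.
    eapply is_derive_cont, is_derive_vpot, HP. }
  assert (Hu : continuous (fun t => upot P mu0 (conf_m d (a t) (b t))) x).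
  { apply (continuous_comp (fun t => conf_m d (a t) (b t))); trivial.
    eapply is_derive_cont, is_derive_upot, HP. }
  cont. nra.
Qed.

(** It rewrites the factor [d^2 - a / (1 + m^2)^2] in the derivative of the potential as
    [conf_q / (1 + m^2)], which cancels the [conf_q] in the denominators of the derivatives of
    [conf_m]. *)
Lemma conf_gap (a b : R) : 0 <= b ->
  (1 + conf_s d a b) * conf_q d a b = d ^ 2 * (1 + conf_s d a b) ^ 2 - a.
Proof. intros Hb. rewrite conf_q_eq. pose proof (conf_s_eq a b Hb). nra. Qed.

Lemma is_derive_potential_a (a b : R) : 0 <= b -> 0 < conf_s d a b ->
  is_derive (fun a => potential d P mu0 a b) a (radial P mu0 (conf_m d a b) / 2).
Proof.
  intros Hb Hs. pose proof (conf_q_pos a b Hb Hs) as Hq.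
  assert (Hm : 0 < conf_m d a b) by now apply sqrt_lt_R0.
  pose proof (conf_gap a b Hb) as G. rewrite <- (conf_m_sqr a b Hb) in G.
  pose proof (is_derive_conf_m_a a b Hb Hs) as Dm.
  set (m := conf_m d a b) in *. set (q := conf_q d a b) in *.
  apply is_derive_ext with (fun a => 1 / 2 * (1 / 2 * (a *
    ((fun t => upot P mu0 t / (1 + t ^ 2)) (conf_m d a b)))
    + d ^ 2 * vpot P mu0 (conf_m d a b))).
  { intros t. unfold potential, Rdiv. simpl. ring. }
  evar (l : R). replace (radial P mu0 m / 2) with l.
  - apply is_derive_Rmult; [apply (is_derive_const (V := R_NormedModule))|].
    apply is_derive_Rplus.
    + apply is_derive_Rmult; [apply (is_derive_const (V := R_NormedModule))|].
      apply is_derive_Rmult; [apply (is_derive_id (K := R_AbsRing))|].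
      apply (is_derive_Rcomp (fun t => upot P mu0 t / (1 + t ^ 2)) (fun a => conf_m d a b)).
      * apply is_derive_upot_axial; [trivial | apply Rgt_not_eq, Hm].
      * exact Dm.
    + apply is_derive_Rmult; [apply (is_derive_const (V := R_NormedModule))|].
      apply (is_derive_Rcomp (vpot P mu0) (fun a => conf_m d a b)).
      * apply is_derive_vpot_axial; [trivial | apply Rgt_not_eq, Hm].
      * exact Dm.
  - unfold l, zero, one; simpl. fold m.
    replace a with (d ^ 2 * (1 + m ^ 2) ^ 2 - (1 + m ^ 2) * q) by lra.
    unfold upot, radial, axial. field. repeat split; nra.
Qed.

Lemma is_derive_potential_b (a b : R) : 0 <= b -> 0 < conf_s d a b ->
  is_derive (fun b => potential d P mu0 a b) b (axial P mu0 (conf_m d a b) / 2).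
Proof.
  intros Hb Hs. pose proof (conf_q_pos a b Hb Hs) as Hq.
  assert (Hm : 0 < conf_m d a b) by now apply sqrt_lt_R0.
  pose proof (conf_gap a b Hb) as G. rewrite <- (conf_m_sqr a b Hb) in G.
  pose proof (is_derive_conf_m_b a b Hb Hs) as Dm.
  set (m := conf_m d a b) in *. set (q := conf_q d a b) in *.
  apply is_derive_ext with (fun b => 1 / 2 * (1 / 2 * (a *
    ((fun t => upot P mu0 t / (1 + t ^ 2)) (conf_m d a b)))
    + d ^ 2 * vpot P mu0 (conf_m d a b))).
  { intros t. unfold potential, Rdiv. simpl. ring. }
  evar (l : R). replace (axial P mu0 m / 2) with l.
  - apply is_derive_Rmult; [apply (is_derive_const (V := R_NormedModule))|].
    apply is_derive_Rplus.
    + apply is_derive_Rmult; [apply (is_derive_const (V := R_NormedModule))|].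
      apply is_derive_Rmult; [apply (is_derive_const (V := R_NormedModule))|].
      apply (is_derive_Rcomp (fun t => upot P mu0 t / (1 + t ^ 2)) (fun b => conf_m d a b)).
      * apply is_derive_upot_axial; [trivial | apply Rgt_not_eq, Hm].
      * exact Dm.
    + apply is_derive_Rmult; [apply (is_derive_const (V := R_NormedModule))|].
      apply (is_derive_Rcomp (vpot P mu0) (fun b => conf_m d a b)).
      * apply is_derive_vpot_axial; [trivial | apply Rgt_not_eq, Hm].
      * exact Dm.
  - unfold l, zero; simpl. fold m.
    replace a with (d ^ 2 * (1 + m ^ 2) ^ 2 - (1 + m ^ 2) * q) by lra.
    field. repeat split; nra.
Qed.

(** In the plane of the disc [conf_m] is identically [0] near [a], so the potential is affine in [a]
    with slope [upot P mu0 0 / 4]. *)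
Lemma is_derive_potential_disc (a : R) : a < d ^ 2 ->
  is_derive (fun a => potential d P mu0 a 0) a (radial P mu0 (conf_m d a 0) / 2).
Proof.
  intros Ha. rewrite conf_m_disc by lra.
  apply is_derive_ext_loc with
    (fun a => 1 / 2 * (1 / 2 * (a * upot P mu0 0) + d ^ 2 * vpot P mu0 0)).
  { assert (Hp : 0 < d ^ 2 - a) by lra. exists (mkposreal _ Hp). intros t Ht.
    assert (Ht' : Rabs (t - a) < d ^ 2 - a) by exact Ht. apply Rabs_def2 in Ht'.
    unfold potential. rewrite conf_m_disc by lra. simpl. field. }
  auto_derive; trivial. unfold upot, radial. unfold I0. rewrite RInt_point.
  unfold zero; simpl. field.
Qed.

(** Only the rim [b = 0], [a = d^2] resists the two previous cases: there [conf_m] has infinite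
    slope from outside, and the formula is recovered as a removable point. *)
Lemma is_derive_potential_radial (a b : R) : 0 <= b ->
  is_derive (fun a => potential d P mu0 a b) a (radial P mu0 (conf_m d a b) / 2).
Proof.
  intros Hb.
  destruct (Rlt_dec 0 b) as [Hb' | Hb'];
    [apply is_derive_potential_a; trivial; apply conf_s_pos; tauto|].
  replace b with 0 in * by lra.
  assert (D : forall t, t <> d ^ 2 ->
    is_derive (fun a => potential d P mu0 a 0) t (radial P mu0 (conf_m d t 0) / 2)).
  { intros t Ht. destruct (Rtotal_order t (d ^ 2)) as [H | [H | H]]; [| lra |].
    - now apply is_derive_potential_disc.
    - apply is_derive_potential_a; trivial. apply conf_s_pos; tauto. }
  destruct (Req_dec a (d ^ 2)) as [-> | Ha]; [|now apply D].
  apply (is_derive_removable (fun a => potential d P mu0 a 0)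
           (fun a => radial P mu0 (conf_m d a 0) / 2) (d ^ 2) 1); [lra| | |].
  - apply (potential_continuous (fun a => a) (fun _ => 0)); cont.
  - assert (Hm : continuous (fun a => conf_m d a 0) (d ^ 2)) by (apply conf_m_continuous; cont).
    apply continuous_Rdiv; [|apply continuous_const|lra].
    apply (continuous_comp (fun a => conf_m d a 0)); trivial. now apply radial_continuous.
  - intros y Hy _. now apply D.
Qed.

(** Across the disc [conf_m d a (z^2)] is not differentiable at [z = 0], but the expected derivative
    [z * axial] tends to [0] because [axial] stays bounded. *)
Lemma is_derive_potential_axial (a z : R) :
  is_derive (fun z => potential d P mu0 a (z ^ 2)) z (z * axial P mu0 (conf_m d a (z ^ 2))).
Proof.
  assert (D : forall t, 0 < conf_s d a (t ^ 2) ->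
    is_derive (fun z => potential d P mu0 a (z ^ 2)) t (t * axial P mu0 (conf_m d a (t ^ 2)))).
  { intros t Ht.
    replace (t * axial P mu0 (conf_m d a (t ^ 2))) with
      ((2 * t) * (axial P mu0 (conf_m d a (t ^ 2)) / 2)) by field.
    apply (is_derive_Rcomp (fun b => potential d P mu0 a b) (fun z => z ^ 2)).
    - apply is_derive_potential_b; trivial. nra.
    - auto_derive; trivial. ring. }
  destruct (Req_dec z 0) as [-> | Hz]; [|apply D, conf_s_pos; [nra | left; nra]].
  destruct (Rlt_dec (d ^ 2) a) as [Ha | Ha].
  { apply D, conf_s_pos; [nra | now right]. }
  apply (is_derive_removable (fun z => potential d P mu0 a (z ^ 2))
           (fun z => z * axial P mu0 (conf_m d a (z ^ 2))) 0 1); [lra| | |].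
  - apply (potential_continuous (fun _ => a) (fun z => z ^ 2)); cont.
  - destruct (axial_bounded P mu0 HP) as [C [HC KC]].
    apply (continuous_vanishing_mult (fun z => z) _ 0 C); [apply continuous_id | trivial |].
    assert (Hm : continuous (fun z => conf_m d a (z ^ 2)) 0)
      by (apply conf_m_continuous; cont).
    generalize (proj1 (filterlim_locally _ _) Hm (mkposreal 1 Rlt_0_1)).
    apply filter_imp. intros t Ht. apply KC. split; [apply conf_m_ge0|].
    change (Rabs (conf_m d a (t ^ 2) - conf_m d a (0 ^ 2)) < 1) in Ht.
    replace (0 ^ 2) with 0 in Ht by ring.
    rewrite conf_m_disc, Rminus_0_r in Ht by lra. pose proof (Rle_abs (conf_m d a (t ^ 2))). lra.
  - intros y Hy _. apply D, conf_s_pos; [nra | left; nra].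
Qed.

End Confocal.

(** * The potential in space *)

Lemma rsq_continuous (p : R * R * R) : continuous rsq p.
Proof.
  apply continuous_ext with (fun p : R * R * R => fst (fst p) ^ 2 + snd (fst p) ^ 2).
  { intros [[x y] z]. reflexivity. }
  cont; apply (continuous_comp fst); [apply continuous_fst | apply continuous_fst
    | apply continuous_fst | apply continuous_snd].
Qed.

Lemma zcoord_continuous (p : R * R * R) : continuous zcoord p.
Proof. apply continuous_snd. Qed.

Section Field.
Variables (d mu0 : R) (P : R -> R).
Hypothesis Hd : 0 < d.
Hypothesis HP : weight P.

Definition spheroidal_mu (p : R * R * R) : R := conf_m d (rsq p) (zcoord p ^ 2).
Definition potential3 (p : R * R * R) : R := potential d P mu0 (rsq p) (zcoord p ^ 2).

Lemma spheroidal_mu_continuous (p : R * R * R) : continuous spheroidal_mu p.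
Proof.
  apply conf_m_continuous; trivial; [apply rsq_continuous|].
  apply (continuous_pow zcoord), zcoord_continuous.
Qed.

Lemma is_derive_potential3_x (x y z : R) :
  is_derive (fun t => potential3 (t, y, z)) x (x * radial P mu0 (spheroidal_mu (x, y, z))).
Proof.
  replace (x * radial P mu0 (spheroidal_mu (x, y, z))) with
    (2 * x * (radial P mu0 (conf_m d (x ^ 2 + y ^ 2) (z ^ 2)) / 2))
    by (unfold spheroidal_mu, rsq, zcoord; simpl; field).
  apply (is_derive_Rcomp (fun a => potential d P mu0 a (z ^ 2)) (fun t => t ^ 2 + y ^ 2)).
  - apply is_derive_potential_radial; trivial. nra.
  - auto_derive; trivial. ring.
Qed.

Lemma is_derive_potential3_y (x y z : R) :
  is_derive (fun t => potential3 (x, t, z)) y (y * radial P mu0 (spheroidal_mu (x, y, z))).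
Proof.
  replace (y * radial P mu0 (spheroidal_mu (x, y, z))) with
    (2 * y * (radial P mu0 (conf_m d (x ^ 2 + y ^ 2) (z ^ 2)) / 2))
    by (unfold spheroidal_mu, rsq, zcoord; simpl; field).
  apply (is_derive_Rcomp (fun a => potential d P mu0 a (z ^ 2)) (fun t => x ^ 2 + t ^ 2)).
  - apply is_derive_potential_radial; trivial. nra.
  - auto_derive; trivial. ring.
Qed.

Lemma is_derive_potential3_z (x y z : R) :
  is_derive (fun t => potential3 (x, y, t)) z (z * axial P mu0 (spheroidal_mu (x, y, z))).
Proof. now apply is_derive_potential_axial. Qed.

Lemma spheroidal_mu_0 (p : R * R * R) : spheroidal_mu p = 0 -> zcoord p = 0 /\ rsq p <= d ^ 2.
Proof.
  intros H. assert (K : ~ (0 < zcoord p ^ 2 \/ d ^ 2 < rsq p)).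
  { intros K. apply conf_m_pos in K; [|trivial|nra]. unfold spheroidal_mu in H. lra. }
  split; [|lra]. destruct (Req_dec (zcoord p) 0); trivial. destruct K. left. nra.
Qed.

Lemma radial_component_continuous (f : R * R * R -> R) (p : R * R * R) :
  continuous f p -> continuous (fun p => f p * radial P mu0 (spheroidal_mu p)) p.
Proof.
  intros Hf. apply continuous_Rmult; trivial.
  apply (continuous_comp spheroidal_mu); [apply spheroidal_mu_continuous|].
  now apply radial_continuous.
Qed.

Lemma axial_component_continuous (p : R * R * R) :
  continuous (fun p => zcoord p * axial P mu0 (spheroidal_mu p)) p.
Proof.
  destruct (Req_dec (spheroidal_mu p) 0) as [H0 | Hm].
  - destruct (axial_bounded P mu0 HP) as [C [HC KC]].
    apply (continuous_vanishing_mult zcoord _ p C); [apply zcoord_continuous | |].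
    { now apply spheroidal_mu_0. }
    generalize (proj1 (filterlim_locally _ _) (spheroidal_mu_continuous p) (mkposreal 1 Rlt_0_1)).
    apply filter_imp. intros t Ht. apply KC. split; [apply conf_m_ge0|].
    change (Rabs (spheroidal_mu t - spheroidal_mu p) < 1) in Ht.
    rewrite H0, Rminus_0_r in Ht. pose proof (Rle_abs (spheroidal_mu t)). lra.
  - apply continuous_Rmult; [apply zcoord_continuous|].
    apply (continuous_comp spheroidal_mu); [apply spheroidal_mu_continuous|].
    now apply axial_continuous.
Qed.

(** * Second derivatives and Poisson's equation *)

Lemma is_derive_radial_conf (a b : R) : 0 <= b -> 0 < conf_m d a b ->
  continuous P (conf_m d a b) ->
  is_derive (fun a => radial P mu0 (conf_m d a b)) a
    (conf_m d a b / (2 * conf_q d a b) *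
     (P (conf_m d a b) * conf_m d a b / (1 + conf_m d a b ^ 2)
      - I0 P (conf_m d a b) / (1 + conf_m d a b ^ 2) ^ 2)).
Proof.
  intros Hb Hm HPm.
  apply (is_derive_Rcomp (radial P mu0) (fun a => conf_m d a b)).
  - now apply is_derive_radial.
  - apply is_derive_conf_m_a; trivial.
    rewrite <- conf_m_sqr by trivial. nra.
Qed.

(** In the plane, [d^2 m^2] is the positive part of [a + h - d^2], hence at most [|h|]; a change of
    [radial] of order [o(m^2)] is thus [o(h)]. This covers the rim as well. *)
Lemma is_derive_radial_disc (a : R) : a <= d ^ 2 -> continuous P 0 ->
  is_derive (fun a => radial P mu0 (conf_m d a 0)) a 0.
Proof.
  intros Ha HP0. apply is_derive_of_eps. intros eps He.
  destruct (radial_near_0 P mu0 HP HP0 (eps * d ^ 2)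
    ltac:(apply Rmult_lt_0_compat; nra)) as [del [Hdel K]].
  assert (Hm : continuous (fun a => conf_m d a 0) a)
    by (apply conf_m_continuous; trivial; cont).
  destruct (continuous_to_eps _ _ Hm del Hdel) as [del' [Hdel' K']].
  exists del'. split; trivial. intros h Hh.
  specialize (K' (a + h)). replace (a + h - a) with h in K' by ring. specialize (K' Hh).
  rewrite (conf_m_disc d Hd a) in * by trivial. rewrite Rminus_0_r in K'.
  pose proof (conf_m_ge0 d (a + h) 0) as Hm0. rewrite Rabs_pos_eq in K' by trivial.
  rewrite Rmult_0_l, Rminus_0_r.
  eapply Rle_trans; [apply K; lra|].
  rewrite Rmult_assoc. apply Rmult_le_compat_l; [lra|].
  rewrite conf_m_sqr by (trivial; lra).
  unfold conf_s, conf_q. replace ((a + h + 0 - d ^ 2) ^ 2 + 4 * d ^ 2 * 0)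
    with (Rsqr (a + h - d ^ 2)) by (unfold Rsqr; ring).
  rewrite sqrt_Rsqr_abs.
  replace (d ^ 2 * ((a + h + 0 - d ^ 2 + Rabs (a + h - d ^ 2)) / (2 * d ^ 2)))
    with ((a + h - d ^ 2 + Rabs (a + h - d ^ 2)) / 2) by (field; nra).
  unfold Rabs; destruct (Rcase_abs h), (Rcase_abs (a + h - d ^ 2)); lra.
Qed.

Lemma is_derive_axial_conf (a z : R) : 0 < conf_m d a (z ^ 2) ->
  continuous P (conf_m d a (z ^ 2)) ->
  let m := conf_m d a (z ^ 2) in
  is_derive (fun z => z * axial P mu0 (conf_m d a (z ^ 2))) z
    (axial P mu0 m + z * (2 * z * ((1 + m ^ 2) / (2 * m * conf_q d a (z ^ 2)))
       * (P m / m - I0 P m / (m ^ 2 * (1 + m ^ 2))))).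
Proof.
  intros Hm HPm m.
  assert (Hs : 0 < conf_s d a (z ^ 2)).
  { rewrite <- conf_m_sqr by (trivial; nra). nra. }
  evar (l : R). match goal with |- is_derive _ _ ?r => replace r with l end.
  - apply (is_derive_Rmult (fun z => z)); [apply (is_derive_id (K := R_AbsRing))|].
    apply (is_derive_Rcomp (axial P mu0) (fun z => conf_m d a (z ^ 2))).
    + apply is_derive_axial; trivial. lra.
    + apply (is_derive_Rcomp (fun b => conf_m d a b) (fun z => z ^ 2)).
      * apply is_derive_conf_m_b; trivial. nra.
      * instantiate (1 := 2 * z). auto_derive; trivial. ring.
  - unfold l. change (@one R_AbsRing) with 1. fold m. ring.
Qed.

Lemma is_derive_axial_disc (a : R) : a <= d ^ 2 -> continuous P 0 ->
  is_derive (fun z => z * axial P mu0 (conf_m d a (z ^ 2))) 0 (P 0 + I1 mu0 P 0).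
Proof.
  intros Ha HP0.
  set (g := fun m => if Req_EM_T m 0 then P 0 + I1 mu0 P 0 else axial P mu0 m).
  (* [conf_m] vanishes only at [z = 0], where the factor [z] hides the difference between [g] and
     [axial]. *)
  apply is_derive_ext with (fun z => g (conf_m d a (z ^ 2)) * z).
  { intros z. unfold g. destruct (Req_EM_T (conf_m d a (z ^ 2)) 0) as [E | _]; [|apply Rmult_comm].
    replace z with 0; [simpl; ring|].
    (* [a] may be negative here, so [Rmax a 0] supplies the squared radius of a genuine point. *)
    symmetry. apply (spheroidal_mu_0 (sqrt (Rmax a 0), 0, z)).
    destruct (Req_dec z 0) as [-> | Hz].
    - unfold spheroidal_mu, rsq, zcoord; cbn [snd]. replace (0 ^ 2) with 0 by ring.
      apply conf_m_disc; trivial. rewrite pow2_sqrt by apply Rmax_r.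
      unfold Rmax; destruct (Rle_dec a 0); nra.
    - pose proof (conf_m_pos d Hd a (z ^ 2) ltac:(nra) ltac:(left; nra)). lra. }
  assert (Hm : continuous (fun z => conf_m d a (z ^ 2)) 0)
    by (apply conf_m_continuous; trivial; cont).
  assert (E : conf_m d a (0 ^ 2) = 0).
  { replace (0 ^ 2) with 0 by ring. now apply conf_m_disc. }
  replace (P 0 + I1 mu0 P 0) with (g (conf_m d a (0 ^ 2)) * 1).
  - apply (is_derive_mult_vanishing (fun z => g (conf_m d a (z ^ 2))) (fun z => z)); trivial.
    + apply (continuous_comp (fun z => conf_m d a (z ^ 2))); trivial. rewrite E.
      now apply axial_limit_0.
    + apply (is_derive_id (K := R_AbsRing)).
  - rewrite E. unfold g. destruct (Req_EM_T 0 0); [ring | tauto].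
Qed.

Lemma is_derive_n_2_of (f g : R -> R) (x l : R) :
  (forall t, is_derive f t (g t)) -> is_derive g x l -> is_derive_n f 2 x l.
Proof.
  intros H K. apply is_derive_ext with g; trivial.
  intros t. symmetry. apply is_derive_unique, H.
Qed.

Lemma is_laplacian_of_radial (x y z l w : R) :
  is_derive (fun a => radial P mu0 (conf_m d a (z ^ 2))) (x ^ 2 + y ^ 2) l ->
  is_derive (fun t => t * axial P mu0 (conf_m d (x ^ 2 + y ^ 2) (t ^ 2))) z w ->
  is_laplacian potential3 (x, y, z)
    (2 * radial P mu0 (conf_m d (x ^ 2 + y ^ 2) (z ^ 2)) + 2 * (x ^ 2 + y ^ 2) * l + w).
Proof.
  intros Hl Hw.
  set (h := radial P mu0 (conf_m d (x ^ 2 + y ^ 2) (z ^ 2))).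
  exists (h + x * (2 * x * l)), (h + y * (2 * y * l)), w.
  split; [|split; [|split]].
  - apply (is_derive_n_2_of _ (fun t => t * radial P mu0 (conf_m d (t ^ 2 + y ^ 2) (z ^ 2))));
      [intros t; apply is_derive_potential3_x|].
    replace h with (1 * h) by ring.
    apply (is_derive_Rmult (fun t => t) (fun t => radial P mu0 (conf_m d (t ^ 2 + y ^ 2) (z ^ 2))));
      [apply (is_derive_id (K := R_AbsRing))|].
    apply (is_derive_Rcomp (fun a => radial P mu0 (conf_m d a (z ^ 2))) (fun t => t ^ 2 + y ^ 2)); trivial.
    auto_derive; trivial. ring.
  - apply (is_derive_n_2_of _ (fun t => t * radial P mu0 (conf_m d (x ^ 2 + t ^ 2) (z ^ 2))));
      [intros t; apply is_derive_potential3_y|].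
    replace h with (1 * h) by ring.
    apply (is_derive_Rmult (fun t => t) (fun t => radial P mu0 (conf_m d (x ^ 2 + t ^ 2) (z ^ 2))));
      [apply (is_derive_id (K := R_AbsRing))|].
    apply (is_derive_Rcomp (fun a => radial P mu0 (conf_m d a (z ^ 2))) (fun t => x ^ 2 + t ^ 2)); trivial.
    auto_derive; trivial. ring.
  - apply (is_derive_n_2_of _ (fun t => t * axial P mu0 (conf_m d (x ^ 2 + y ^ 2) (t ^ 2))));
      [intros t; apply is_derive_potential3_z | exact Hw].
  - ring.
Qed.

Lemma is_laplacian_potential3 (p : R * R * R) : continuous P (spheroidal_mu p) ->
  is_laplacian potential3 p (P (spheroidal_mu p)).
Proof.
  destruct p as [[x y] z]. intros HPm.
  destruct (Req_dec (spheroidal_mu (x, y, z)) 0) as [H0 | Hn].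
  - pose proof (spheroidal_mu_0 _ H0) as [Hz Ha]. rewrite H0 in *.
    unfold spheroidal_mu, zcoord, rsq in *; cbn [snd] in *. subst z.
    (* On the disc [2 * radial] equals [- I1 mu0 P 0], which cancels the [I1] term of the axial part
       and leaves [P 0]. *)
    replace (P 0) with (2 * radial P mu0 (conf_m d (x ^ 2 + y ^ 2) (0 ^ 2))
      + 2 * (x ^ 2 + y ^ 2) * 0 + (P 0 + I1 mu0 P 0)).
    + apply is_laplacian_of_radial.
      * replace (0 ^ 2) with 0 by ring. now apply is_derive_radial_disc.
      * now apply is_derive_axial_disc.
    + rewrite H0. unfold radial, I0. rewrite RInt_point. unfold zero; simpl. field.
  - assert (Hm : 0 < spheroidal_mu (x, y, z)).
    { pose proof (conf_m_ge0 d (rsq (x, y, z)) (zcoord (x, y, z) ^ 2)).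
      unfold spheroidal_mu in *. lra. }
    unfold spheroidal_mu, zcoord, rsq in *; cbn [snd] in *.
    evar (l : R). replace (P (conf_m d (x ^ 2 + y ^ 2) (z ^ 2))) with l.
    + apply is_laplacian_of_radial.
      * apply is_derive_radial_conf; trivial. nra.
      * now apply is_derive_axial_conf.
    + unfold l. clear l HPm Hn.
      assert (Hb : 0 <= z ^ 2) by nra.
      pose proof (conf_m_sqr d Hd (x ^ 2 + y ^ 2) (z ^ 2) Hb) as Em.
      pose proof (conf_gap d Hd (x ^ 2 + y ^ 2) (z ^ 2) Hb) as G.
      pose proof (conf_s_eq d Hd (x ^ 2 + y ^ 2) (z ^ 2) Hb) as S.
      assert (Hq : 0 < conf_q d (x ^ 2 + y ^ 2) (z ^ 2)).
      { apply conf_q_pos; trivial. rewrite <- Em. nra. }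
      replace (2 * z * ((1 + conf_m d (x ^ 2 + y ^ 2) (z ^ 2) ^ 2) /
          (2 * conf_m d (x ^ 2 + y ^ 2) (z ^ 2) * conf_q d (x ^ 2 + y ^ 2) (z ^ 2))))
        with (z * ((1 + conf_m d (x ^ 2 + y ^ 2) (z ^ 2) ^ 2) /
          (conf_m d (x ^ 2 + y ^ 2) (z ^ 2) * conf_q d (x ^ 2 + y ^ 2) (z ^ 2))))
        by (field; lra).
      set (m := conf_m d (x ^ 2 + y ^ 2) (z ^ 2)) in *.
      set (q := conf_q d (x ^ 2 + y ^ 2) (z ^ 2)) in *.
      rewrite <- Em in *. set (a := x ^ 2 + y ^ 2) in *.
      match goal with |- context [z * (z * ?e * ?f)] =>
        replace (z * (z * e * f)) with (z ^ 2 * (e * f)) by ring end.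
      (* With [a] and [z^2] expressed through [m] and [q], the Laplacian becomes a rational identity
         in which all terms in [I0] and [I1] cancel. *)
      assert (Ea : a = d ^ 2 * (1 + m ^ 2) ^ 2 - (1 + m ^ 2) * q) by lra.
      assert (Eb : z ^ 2 = m ^ 2 * (q - d ^ 2 * m ^ 2)).
      { rewrite Ea in S. apply Rmult_eq_reg_l with (1 + m ^ 2); [|nra]. nra. }
      rewrite Eb, Ea. unfold radial, axial. field. repeat split; nra.
Qed.

(** Along suitable curves through [p], parametrised by the spheroidal coordinate, the
    density field is [P]. *)
Lemma continuous_profile (p : R * R * R) : (forall m, m <= 0 -> P m = P 0) ->
  continuous (fun p => P (spheroidal_mu p)) p -> continuous P (spheroidal_mu p).
Proof.
  intros Pneg Hf. destruct p as [[x y] z].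
  destruct (Req_dec (spheroidal_mu (x, y, z)) 0) as [H0 | Hn].
  - pose proof (spheroidal_mu_0 _ H0) as [Hz Ha]. rewrite H0 in *.
    unfold zcoord, rsq in *; cbn [snd] in *. subst z.
    (* [c] is the positive part of [m], and [ga] rises vertically from the disc point, meeting the
       spheroid of level [c m]. *)
    set (c := fun m => (m + Rabs m) / 2).
    set (ga := fun m => (x, y, c m * sqrt (d ^ 2 - (x ^ 2 + y ^ 2) / (1 + c m ^ 2)))).
    assert (Cc : continuous c 0).
    { unfold c. apply continuous_Rdiv; [|apply continuous_const|lra]. cont. apply continuous_Rabs. }
    assert (C0 : c 0 = 0) by (unfold c; rewrite Rabs_R0; field).
    assert (Cge : forall m, 0 <= c m).
    { intros m. unfold c. pose proof (Rle_abs (- m)). rewrite Rabs_Ropp in H. lra. }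
    assert (Cga : continuous ga 0).
    { unfold ga. apply continuous_pair; [apply continuous_const|].
      apply continuous_Rmult; trivial. apply (continuous_comp _ sqrt); [|apply continuous_sqrt].
      cont. rewrite C0. nra. }
    assert (Ega : forall m, spheroidal_mu (ga m) = c m).
    { intros m. unfold ga, spheroidal_mu, rsq, zcoord; cbn [snd].
      set (t := c m). assert (Ht : 0 <= t) by apply Cge.
      assert (Hl : 0 <= d ^ 2 - (x ^ 2 + y ^ 2) / (1 + t ^ 2)).
      { apply Rmult_le_reg_r with (1 + t ^ 2); [nra|].
        replace ((d ^ 2 - (x ^ 2 + y ^ 2) / (1 + t ^ 2)) * (1 + t ^ 2)) with
          (d ^ 2 * (1 + t ^ 2) - (x ^ 2 + y ^ 2)) by (field; nra).
        assert (0 <= d ^ 2 * t ^ 2) by (apply Rmult_le_pos; nra). lra. }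
      rewrite Rpow_mult_distr, pow2_sqrt by trivial.
      destruct Ht as [Ht | Ht].
      - apply conf_m_spheroid; trivial.
        + apply Rmult_le_pos; [nra | trivial].
        + field. nra.
      - rewrite <- Ht. replace (0 ^ 2 * (d ^ 2 - (x ^ 2 + y ^ 2) / (1 + 0 ^ 2))) with 0 by field.
        apply conf_m_disc; [exact Hd | exact Ha]. }
    apply continuous_ext with (fun m => P (spheroidal_mu (ga m))).
    { intros m. rewrite Ega. unfold c. destruct (Rle_dec m 0) as [Hm | Hm].
      - rewrite Rabs_left1 by trivial. rewrite (Pneg m Hm). f_equal. field.
      - rewrite Rabs_pos_eq by lra. f_equal. field. }
    apply (continuous_comp ga (fun p => P (spheroidal_mu p))); trivial.
    replace (ga 0) with (x, y, 0); trivial. unfold ga. rewrite C0. f_equal. ring.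
  - assert (Hm : 0 < spheroidal_mu (x, y, z)).
    { pose proof (conf_m_ge0 d (rsq (x, y, z)) (zcoord (x, y, z) ^ 2)).
      unfold spheroidal_mu in *. lra. }
    assert (Hb : 0 <= z ^ 2) by nra.
    assert (S : (x ^ 2 + y ^ 2) * spheroidal_mu (x, y, z) ^ 2
      + z ^ 2 * (1 + spheroidal_mu (x, y, z) ^ 2) =
      d ^ 2 * spheroidal_mu (x, y, z) ^ 2 * (1 + spheroidal_mu (x, y, z) ^ 2)).
    { unfold spheroidal_mu, rsq, zcoord; cbn [snd]. rewrite conf_m_sqr by trivial.
      pose proof (conf_s_eq d Hd (x ^ 2 + y ^ 2) (z ^ 2) Hb). lra. }
    set (m0 := spheroidal_mu (x, y, z)) in *.
    (* [ga] is the image of the point under the axis-wise scaling that maps the spheroid of level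
       [m0] onto that of level [m]. *)
    set (s := fun m => sqrt ((1 + m ^ 2) / (1 + m0 ^ 2))).
    set (ga := fun m => (x * s m, y * s m, z * (m / m0))).
    assert (Cs : forall m, continuous s m).
    { intros m. unfold s. apply (continuous_comp _ sqrt); [|apply continuous_sqrt]. cont. nra. }
    assert (Cga : continuous ga m0).
    { unfold ga. repeat apply continuous_pair; cont; apply Cs. }
    apply continuous_ext_loc with (fun m => P (spheroidal_mu (ga m))).
    { exists (mkposreal m0 Hm). intros m Hball.
      assert (Hball' : Rabs (m - m0) < m0) by exact Hball. apply Rabs_def2 in Hball'.
      f_equal. unfold ga, spheroidal_mu, rsq, zcoord; cbn [snd].
      assert (Es : s m ^ 2 = (1 + m ^ 2) / (1 + m0 ^ 2)).
      { apply pow2_sqrt. apply Rdiv_le_0_compat; nra. }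
      rewrite !Rpow_mult_distr, Es. apply conf_m_spheroid; [trivial | | lra |].
      - apply Rmult_le_pos; nra.
      - replace (x ^ 2 * ((1 + m ^ 2) / (1 + m0 ^ 2)) + y ^ 2 * ((1 + m ^ 2) / (1 + m0 ^ 2)))
          with ((x ^ 2 + y ^ 2) * ((1 + m ^ 2) / (1 + m0 ^ 2))) by ring.
        transitivity ((1 + m ^ 2) * m ^ 2 / (m0 ^ 2 * (1 + m0 ^ 2)) *
          ((x ^ 2 + y ^ 2) * m0 ^ 2 + z ^ 2 * (1 + m0 ^ 2))).
        + field. split; nra.
        + rewrite S. field. split; nra. }
    apply (continuous_comp ga (fun p => P (spheroidal_mu p))); trivial.
    replace (ga m0) with (x, y, z); trivial. unfold ga.
    replace (s m0) with 1.
    + f_equal; [f_equal; ring | field; lra].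
    + unfold s. replace ((1 + m0 ^ 2) / (1 + m0 ^ 2)) with 1 by (field; nra). symmetry; apply sqrt_1.
Qed.

(** * Decay at infinity *)

Lemma arccot_upper (m : R) : 0 < m -> arccot m <= / m.
Proof.
  intros Hm. unfold arccot. rewrite <- atan_inv by trivial.
  pose proof (Rinv_0_lt_compat m Hm) as H.
  destruct (MVT_gen atan 0 (/ m) (fun t => / (1 + Rsqr t))) as [c [Hc E]].
  - intros t _. apply is_derive_atan.
  - intros t _. apply continuity_pt_filterlim. eapply is_derive_cont, is_derive_atan.
  - rewrite atan_0 in E. assert (0 < / (1 + c²) <= 1).
    { unfold Rsqr. split; [apply Rinv_0_lt_compat; nra|].
      rewrite <- Rinv_1. apply Rinv_le_contravar; nra. }
    nra.
Qed.

Lemma arccot_lower (m : R) : 0 < m -> m / (1 + m ^ 2) <= arccot m.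
Proof.
  intros Hm. unfold arccot. rewrite <- atan_inv by trivial.
  pose proof (Rinv_0_lt_compat m Hm) as H.
  destruct (MVT_gen atan 0 (/ m) (fun t => / (1 + Rsqr t))) as [c [Hc E]].
  - intros t _. apply is_derive_atan.
  - intros t _. apply continuity_pt_filterlim. eapply is_derive_cont, is_derive_atan.
  - rewrite Rmin_left, Rmax_right in Hc by lra. rewrite atan_0 in E.
    replace (m / (1 + m ^ 2)) with (/ (1 + (/ m) ^ 2) * / m) by (field; split; nra).
    replace (atan (/ m)) with (/ (1 + c²) * / m) by lra.
    apply Rmult_le_compat_r; [lra|]. apply Rinv_le_contravar; unfold Rsqr; nra.
Qed.

(** [d * sqrt (1 + m^2)] is the larger semi-axis of the spheroid. It follows that [mu] tends to
    infinity with the distance from the origin. *)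
Lemma spheroidal_mu_size (p : R * R * R) :
  rsq p + zcoord p ^ 2 <= d ^ 2 * (1 + spheroidal_mu p ^ 2).
Proof.
  assert (Hb : 0 <= zcoord p ^ 2) by nra. unfold spheroidal_mu. rewrite conf_m_sqr by trivial.
  pose proof (conf_s_eq d Hd (rsq p) _ Hb) as S. pose proof (conf_s_ge0 d Hd (rsq p) _ Hb) as H.
  pose proof (conf_q_eq d Hd (rsq p) (zcoord p ^ 2)) as Q.
  pose proof (conf_q_ge d (rsq p) _ Hb) as K. apply Rabs_le_between in K.
  destruct H as [H | H]; [|rewrite <- H in *; lra].
  apply Rmult_le_reg_r with (conf_s d (rsq p) (zcoord p ^ 2)); trivial. nra.
Qed.

Hypothesis Hmu0 : 0 < mu0.
Hypothesis Pout : forall m, mu0 < m -> P m = 0.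

Lemma outer_RInt_zero (phi : R -> R) (m : R) : mu0 <= m ->
  RInt (fun t => P t * phi t) mu0 m = 0.
Proof.
  intros Hm. rewrite (RInt_ext _ (fun _ => 0)).
  - rewrite RInt_const. apply Rmult_0_r.
  - intros t Ht. rewrite Rmin_left in Ht by trivial. rewrite Pout by lra. apply Rmult_0_l.
Qed.

Lemma I0_outside (m : R) : mu0 <= m -> I0 P m = I0 P mu0.
Proof.
  intros Hm. unfold I0.
  rewrite <- (RInt_Chasles (fun t => P t * (1 + 3 * t ^ 2)) 0 mu0 m)
    by apply HP, I0_weight_continuous.
  rewrite (outer_RInt_zero (fun t => 1 + 3 * t ^ 2)) by trivial. apply Rplus_0_r.
Qed.

Lemma I1_outside (m : R) : mu0 <= m -> I1 mu0 P m = 0.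
Proof. intros Hm. now apply (outer_RInt_zero (fun t => (1 + 3 * t ^ 2) * arccot t - 3 * t)). Qed.

Lemma I2_outside (m : R) : mu0 <= m -> I2 mu0 P m = 0.
Proof. intros Hm. rewrite I2_flip. now apply (outer_RInt_zero (fun t => t)). Qed.

(** Outside the body only [I0 P mu0] survives. Its factors are combinations of [arccot m] and
    [B = (1 + m^2) arccot m - m], both between [0] and [1 / m], and [a / (1 + m^2) <= d^2]. *)
Lemma potential3_decay (p : R * R * R) : mu0 <= spheroidal_mu p -> 1 <= spheroidal_mu p ->
  Rabs (potential3 p) <= 4 * d ^ 2 * Rabs (I0 P mu0) / spheroidal_mu p.
Proof.
  intros Hm Hm1. pose proof (spheroidal_mu_size p) as Hsz. pose proof (rsq_ge0 p) as Ha.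
  unfold potential3, potential. fold (spheroidal_mu p). set (m := spheroidal_mu p) in *.
  unfold upot, vpot. rewrite I0_outside, I1_outside, I2_outside by trivial.
  set (J := I0 P mu0). set (a := rsq p) in *.
  pose proof (arccot_upper m ltac:(lra)) as U. pose proof (arccot_lower m ltac:(lra)) as L.
  assert (HB : 0 <= (1 + m ^ 2) * arccot m - m <= / m).
  { split.
    - apply Rmult_le_compat_l with (r := 1 + m ^ 2) in L; [|nra].
      replace ((1 + m ^ 2) * (m / (1 + m ^ 2))) with m in L by (field; nra). lra.
    - apply Rmult_le_compat_l with (r := 1 + m ^ 2) in U; [|nra].
      replace ((1 + m ^ 2) * / m) with (m + / m) in U by (field; lra). lra. }
  assert (Hacc : 0 <= arccot m).
  { eapply Rle_trans; [|exact L]. apply Rdiv_le_0_compat; nra. }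
  set (B := (1 + m ^ 2) * arccot m - m) in *.
  set (q := a / (1 + m ^ 2)).
  assert (Hq : 0 <= q <= d ^ 2).
  { unfold q. split; [apply Rdiv_le_0_compat; nra|].
    apply Rmult_le_reg_r with (1 + m ^ 2); [nra|].
    replace (a / (1 + m ^ 2) * (1 + m ^ 2)) with a by (field; nra). nra. }
  (* The bracket of [upot] is rewritten by [(1 + 3 m^2) arccot m - 3 m = 3 B - 2 arccot m], which
     exposes the cancellation of its growing terms. *)
  replace (1 / 2 * (1 / 2 * (a * (J * ((1 + 3 * m ^ 2) * arccot m - 3 * m) - 0 * (1 + 3 * m ^ 2)) / (1 + m ^ 2))
      + d ^ 2 * (- J * B + 0 * (1 + m ^ 2) + 2 * 0)))
    with (J * (1 / 4 * (q * (3 * B - 2 * arccot m)) - 1 / 2 * (d ^ 2 * B)))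
    by (unfold q, B; field; nra).
  rewrite Rabs_mult.
  replace (4 * d ^ 2 * Rabs J / m) with (Rabs J * (4 * (d ^ 2 * / m))) by (field; lra).
  apply Rmult_le_compat_l; [apply Rabs_pos|].
  assert (0 < / m) by (apply Rinv_0_lt_compat; lra).
  assert (Hd2 : 0 < d ^ 2) by nra.
  assert (T1 : Rabs (q * (3 * B - 2 * arccot m)) <= d ^ 2 * (3 * / m)).
  { rewrite Rabs_mult, (Rabs_pos_eq q) by lra.
    apply Rmult_le_compat; [lra | apply Rabs_pos | lra |]. apply Rabs_le. lra. }
  assert (T2 : 0 <= d ^ 2 * B <= d ^ 2 * / m) by (split; nra).
  apply Rabs_le_between in T1. apply Rabs_le. lra.
Qed.

Lemma potential3_vanishes (k : R) : vanishes_at_infinity (fun p => k * potential3 p).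
Proof.
  intros eps He.
  set (C := Rabs k * (4 * d ^ 2 * Rabs (I0 P mu0))).
  assert (HC : 0 <= C).
  { unfold C. pose proof (Rabs_pos k). pose proof (Rabs_pos (I0 P mu0)).
    apply Rmult_le_pos; trivial. apply Rmult_le_pos; nra. }
  set (M := mu0 + 1 + C / eps).
  assert (HCe : 0 <= C / eps) by (apply Rdiv_le_0_compat; lra).
  exists (d * (1 + M)). intros p Hp.
  assert (Hm : M < spheroidal_mu p).
  { apply Rnot_le_lt. intros Hle. pose proof (spheroidal_mu_size p) as S.
    apply (Rlt_irrefl (d * (1 + M))). eapply Rlt_le_trans; [exact Hp|].
    rewrite <- (sqrt_pow2 (d * (1 + M))) by (apply Rmult_le_pos; unfold M; lra).
    apply sqrt_le_1_alt. eapply Rle_trans; [exact S|].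
    rewrite Rpow_mult_distr. apply Rmult_le_compat_l; [nra|].
    pose proof (conf_m_ge0 d (rsq p) (zcoord p ^ 2)). fold (spheroidal_mu p) in *.
    assert (0 <= M) by (unfold M; lra). nra. }
  unfold M in Hm. rewrite Rabs_mult.
  eapply Rle_lt_trans.
  { apply Rmult_le_compat_l; [apply Rabs_pos | apply potential3_decay; lra]. }
  replace (Rabs k * (4 * d ^ 2 * Rabs (I0 P mu0) / spheroidal_mu p))
    with (C / spheroidal_mu p) by (unfold C; field; lra).
  apply Rmult_lt_reg_r with (spheroidal_mu p); [lra|].
  replace (C / spheroidal_mu p * spheroidal_mu p) with C by (field; lra).
  assert (H : C / eps < spheroidal_mu p) by lra.
  apply Rmult_lt_compat_r with (r := eps) in H; trivial.
  replace (C / eps * eps) with C in H by (field; lra). lra.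
Qed.

Lemma potential3_gravitational (G : R) :
  (forall m, m <= 0 -> P m = P 0) ->
  is_gravitational_potential G (fun p => P (spheroidal_mu p)) (fun p => 4 * PI * G * potential3 p).
Proof.
  intros Pneg. set (k := 4 * PI * G).
  assert (Dscal : forall (f : R -> R) x l, is_derive f x l -> is_derive (fun t => k * f t) x (k * l)).
  { intros f x l H. apply (is_derive_scal f x k l H). }
  split; [split|split].
  - intros x y z. repeat split; eexists; apply Dscal;
    [apply is_derive_potential3_x | apply is_derive_potential3_y | apply is_derive_potential3_z].
  - intros p. repeat split.
    + apply continuous_ext with (fun p => k * (fst (fst p) * radial P mu0 (spheroidal_mu p))).
      { intros [[x y] z]. symmetry. apply is_derive_unique. apply Dscal, is_derive_potential3_x. }
      apply continuous_Rmult; [apply continuous_const|].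
      apply (radial_component_continuous (fun p => fst (fst p))).
      apply (continuous_comp fst); apply continuous_fst.
    + apply continuous_ext with (fun p => k * (snd (fst p) * radial P mu0 (spheroidal_mu p))).
      { intros [[x y] z]. symmetry. apply is_derive_unique. apply Dscal, is_derive_potential3_y. }
      apply continuous_Rmult; [apply continuous_const|].
      apply (radial_component_continuous (fun p => snd (fst p))).
      apply (continuous_comp fst); [apply continuous_fst | apply continuous_snd].
    + apply continuous_ext with (fun p => k * (zcoord p * axial P mu0 (spheroidal_mu p))).
      { intros [[x y] z]. symmetry. apply is_derive_unique. apply Dscal, is_derive_potential3_z. }
      apply continuous_Rmult; [apply continuous_const | apply axial_component_continuous].
  - apply potential3_vanishes.
  - intros p Hp. apply continuous_profile in Hp; trivial.
    pose proof (is_laplacian_potential3 p Hp) as L. destruct p as [[x y] z].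
    destruct L as [a [b [c [Ha [Hb [Hc E]]]]]].
    exists (k * a), (k * b), (k * c).
    split; [|split; [|split]]; try (now apply is_derive_n_scal_l).
    rewrite E. unfold k. ring.
Qed.

End Field.

(** * Admissible densities *)

(** Continuing [rho] by [rho 0] to the left makes one-sided continuity at the focal disc
    ordinary continuity. *)
Definition profile (mu0 : R) (rho : R -> R) (m : R) : R :=
  if Rle_dec m mu0 then rho (Rmax 0 m) else 0.

Section Profile.
Variables (mu0 : R) (rho : R -> R).
Hypothesis Hmu0 : 0 < mu0.

Lemma profile_in (m : R) : 0 <= m <= mu0 -> profile mu0 rho m = rho m.
Proof.
  intros Hm. unfold profile. destruct (Rle_dec m mu0); [|lra]. now rewrite Rmax_right.
Qed.

Lemma profile_left (m : R) : m <= 0 -> profile mu0 rho m = profile mu0 rho 0.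
Proof.
  intros Hm. rewrite (profile_in 0) by lra. unfold profile.
  destruct (Rle_dec m mu0); [|lra]. now rewrite Rmax_left.
Qed.

Lemma profile_right (m : R) : mu0 < m -> profile mu0 rho m = 0.
Proof. intros Hm. unfold profile. destruct (Rle_dec m mu0); lra. Qed.

(** Clamping to [[0, mu0]] is a 1-Lipschitz retraction, so continuity relative to the interval
    becomes continuity on the whole line. *)
Lemma profile_clamp_continuous :
  continuous_on (fun m => 0 <= m <= mu0) rho ->
  forall x, continuous (fun t => rho (Rmax 0 (Rmin t mu0))) x.
Proof.
  intros H x. set (c := fun t => Rmax 0 (Rmin t mu0)).
  assert (Hc : forall t, 0 <= c t <= mu0).
  { intros t. unfold c, Rmax, Rmin. destruct (Rle_dec t mu0); destruct Rle_dec; lra. }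
  assert (Hl : forall s t, Rabs (c s - c t) <= Rabs (s - t)).
  { intros s t. unfold c, Rmax, Rmin.
    destruct (Rle_dec s mu0), (Rle_dec t mu0); repeat destruct Rle_dec;
    unfold Rabs; repeat destruct Rcase_abs; lra. }
  apply continuous_of_eps. intros eps He.
  pose proof (proj1 (filterlim_locally rho (rho (c x))) (H (c x) (Hc x)) (mkposreal eps He))
    as [del K].
  exists del. split; [apply cond_pos|]. intros y Hy.
  apply (K (c y)); [|apply Hc].
  change (Rabs (c y - c x) < del). eapply Rle_lt_trans; [apply Hl | exact Hy].
Qed.

Lemma ex_RInt_step (phi : R -> R) (l lf : list R) :
  (forall x, continuous phi x) -> adapted_couple rho 0 mu0 l lf ->
  ex_RInt (fun t => rho t * phi t) 0 mu0.
Proof.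
  intros Hphi (Ho & H0 & Hn & Hlen & Hc).
  rewrite Rmin_left in H0 by lra. rewrite Rmax_right in Hn by lra.
  assert (K : forall i, (i <= Init.Nat.pred (length l))%nat ->
    ex_RInt (fun t => rho t * phi t) (RList.pos_Rl l 0) (RList.pos_Rl l i)).
  { induction i as [|i IH]; intros Hi; [apply ex_RInt_point|].
    apply (ex_RInt_Chasles (V := R_NormedModule)) with (RList.pos_Rl l i); [apply IH; lia|].
    assert (Hi' : (i < Init.Nat.pred (length l))%nat) by lia.
    apply (ex_RInt_ext (V := R_NormedModule)) with (fun t => RList.pos_Rl lf i * phi t).
    - intros t Ht. rewrite Rmin_left, Rmax_right in Ht by (apply Ho; exact Hi').
      rewrite (Hc i Hi' t Ht). reflexivity.
    - apply (ex_RInt_continuous (V := R_CompleteNormedModule)). intros t _.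
      apply continuous_Rmult; [apply continuous_const | apply Hphi]. }
  specialize (K _ (le_n _)). rewrite H0, Hn in K. exact K.
Qed.

Lemma weight_profile : admissible_density mu0 rho -> weight (profile mu0 rho).
Proof.
  intros [_ Hrho] phi Hphi.
  set (f := fun t => profile mu0 rho t * phi t).
  assert (M : ex_RInt f 0 mu0).
  { apply (ex_RInt_ext (V := R_NormedModule)) with (fun t => rho t * phi t).
    { intros t Ht. rewrite Rmin_left, Rmax_right in Ht by lra.
      unfold f. rewrite profile_in by lra. reflexivity. }
    destruct Hrho as [Hrho | [[l [lf Hrho]]]].
    - apply (ex_RInt_ext (V := R_NormedModule)) with (fun t => rho (Rmax 0 (Rmin t mu0)) * phi t).
      + intros t Ht. rewrite Rmin_left, Rmax_right in Ht by lra.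
        rewrite Rmin_left, Rmax_right by lra. reflexivity.
      + apply (ex_RInt_continuous (V := R_CompleteNormedModule)). intros t _.
        apply continuous_Rmult; [now apply profile_clamp_continuous | apply Hphi].
    - now apply ex_RInt_step with l lf. }
  assert (Lft : forall a, a <= 0 -> ex_RInt f a 0).
  { intros a Ha. apply (ex_RInt_ext (V := R_NormedModule)) with (fun t => profile mu0 rho 0 * phi t).
    - intros t Ht. rewrite Rmin_left, Rmax_right in Ht by lra.
      unfold f. rewrite (profile_left t) by lra. reflexivity.
    - apply (ex_RInt_continuous (V := R_CompleteNormedModule)). intros t _.
      apply continuous_Rmult; [apply continuous_const | apply Hphi]. }
  assert (Rgt : forall b, mu0 <= b -> ex_RInt f mu0 b).
  { intros b Hb. apply (ex_RInt_ext (V := R_NormedModule)) with (fun t => 0).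
    - intros t Ht. rewrite Rmin_left, Rmax_right in Ht by lra.
      unfold f. rewrite (profile_right t) by lra. symmetry; apply Rmult_0_l.
    - apply (ex_RInt_const (V := R_NormedModule)). }
  assert (Le : forall a b, a <= b -> ex_RInt f a b).
  (* The interval is enlarged to contain [[0, mu0]], integrated over the three pieces, and then
     restricted to [[a, b]]. *)
  { intros a b Hab. set (A := Rmin a 0). set (B := Rmax b mu0).
    assert (HA : A <= a /\ A <= 0) by (split; [apply Rmin_l | apply Rmin_r]).
    assert (HB : b <= B /\ mu0 <= B) by (split; [apply Rmax_l | apply Rmax_r]).
    assert (W : ex_RInt f A B).
    { apply (ex_RInt_Chasles (V := R_NormedModule)) with mu0; [|now apply Rgt].
      apply (ex_RInt_Chasles (V := R_NormedModule)) with 0; [now apply Lft | exact M]. }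
    apply (ex_RInt_Chasles_1 (V := R_CompleteNormedModule)) with B; [lra|].
    apply (ex_RInt_Chasles_2 (V := R_CompleteNormedModule)) with A; [lra | exact W]. }
  intros a b. destruct (Rle_dec a b) as [H | H]; [now apply Le|].
  apply (ex_RInt_swap (V := R_NormedModule)), Le. lra.
Qed.

Lemma subdivision_cases (l : list R) (m : R) (i : nat) :
  RList.pos_Rl l 0 <= m <= RList.pos_Rl l i ->
  (exists j, (j <= i)%nat /\ m = RList.pos_Rl l j) \/
  (exists j, (j < i)%nat /\ RList.pos_Rl l j < m < RList.pos_Rl l (S j)).
Proof.
  induction i as [|i IH]; intros Hm.
  - left. exists 0%nat. split; [lia | lra].
  - destruct (Rlt_dec (RList.pos_Rl l i) m) as [H | H].
    + destruct (Req_dec m (RList.pos_Rl l (S i))) as [E | E].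
      * left. exists (S i). now split.
      * right. exists i. split; [lia | lra].
    + destruct IH as [[j [Hj E]] | [j [Hj E]]]; [lra | left | right]; exists j; split; trivial; lia.
Qed.

(** Level [0] is excluded because the focal disc lies in the plane [z = 0], which the uniqueness
    argument treats separately. [mu0] is always listed, being the last subdivision point in the
    layered case. *)
Lemma profile_discontinuities : admissible_density mu0 rho ->
  exists L : list R, forall m, 0 < m -> ~ In m L -> continuous (profile mu0 rho) m.
Proof.
  intros [_ Hrho].
  assert (Out : forall m, mu0 < m -> continuous (profile mu0 rho) m).
  { intros m Hm. apply continuous_ext_loc with (fun _ => 0); [|apply continuous_const].
    assert (Hp : 0 < m - mu0) by lra. exists (mkposreal _ Hp). intros t Ht.
    assert (Ht' : Rabs (t - m) < m - mu0) by exact Ht. apply Rabs_def2 in Ht'.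
    symmetry. apply profile_right. lra. }
  destruct Hrho as [Hrho | [[l [lf (Ho & H0 & Hn & Hlen & Hc)]]]].
  - exists (mu0 :: nil). intros m Hm Hin.
    destruct (Rtotal_order m mu0) as [H | [H | H]]; [| |now apply Out].
    + apply continuous_ext_loc with (fun t => rho (Rmax 0 (Rmin t mu0)));
        [|now apply profile_clamp_continuous].
      assert (Hp : 0 < mu0 - m) by lra. exists (mkposreal _ Hp). intros t Ht.
      assert (Ht' : Rabs (t - m) < mu0 - m) by exact Ht. apply Rabs_def2 in Ht'.
      unfold profile. destruct (Rle_dec t mu0); [|lra]. now rewrite Rmin_left.
    + destruct Hin. left. now symmetry.
  - rewrite Rmin_left in H0 by lra. rewrite Rmax_right in Hn by lra.
    exists l. intros m Hm Hin.
    destruct (Rlt_dec mu0 m) as [H | H]; [now apply Out|].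
    destruct (subdivision_cases l m (Init.Nat.pred (length l))) as [[j [Hj E]] | [j [Hj E]]].
    { rewrite H0, Hn. lra. }
    { destruct Hin. rewrite E. apply RList.pos_Rl_P2. exists j. split; trivial.
      destruct l; simpl in *; lia. }
    apply continuous_ext_loc with (fun _ => RList.pos_Rl lf j); [|apply continuous_const].
    (* The entry [m] keeps the neighbourhood to the right of [0], where [profile] agrees with
       [rho]. *)
    assert (Hp : 0 < Rmin m (Rmin (m - RList.pos_Rl l j) (RList.pos_Rl l (S j) - m)))
      by (repeat apply Rmin_pos; lra).
    exists (mkposreal _ Hp). intros t Ht.
    assert (Ht' : Rabs (t - m) < Rmin m (Rmin (m - RList.pos_Rl l j) (RList.pos_Rl l (S j) - m)))
      by exact Ht.
    apply Rmin_Rgt_l in Ht'. destruct Ht' as [T1 T2]. apply Rmin_Rgt_l in T2.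
    destruct T2 as [T2 T3]. apply Rgt_lt, Rabs_def2 in T1, T2, T3.
    assert (Hlast : RList.pos_Rl l (S j) <= mu0).
    { rewrite <- Hn. apply RList.RList_P7; trivial. apply RList.pos_Rl_P2.
      exists (S j). split; trivial. lia. }
    rewrite profile_in by lra. symmetry. apply (Hc j Hj). split; lra.
Qed.

Lemma density_field_profile (mu : R * R * R -> R) (p : R * R * R) :
  0 <= mu p -> density_field mu0 rho mu p = profile mu0 rho (mu p).
Proof.
  intros H. unfold density_field, profile. destruct (Rle_dec (mu p) mu0); trivial.
  now rewrite Rmax_right.
Qed.

Hypothesis Hrho : admissible_density mu0 rho.

Lemma profile_RInt (phi : R -> R) (a m : R) : 0 <= a <= mu0 -> 0 <= m <= mu0 ->
  RInt (fun t => rho t * phi t) a m = RInt (fun t => profile mu0 rho t * phi t) a m.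
Proof.
  intros Ha Hm. apply RInt_ext. intros t Ht.
  assert (0 <= t <= mu0).
  { revert Ht. unfold Rmin, Rmax. destruct (Rle_dec a m); lra. }
  now rewrite profile_in.
Qed.

Lemma I0_profile (m : R) : 0 <= m <= mu0 -> I0 rho m = I0 (profile mu0 rho) m.
Proof. intros Hm. apply (profile_RInt (fun t => 1 + 3 * t ^ 2)); lra. Qed.

Lemma u_tilde_profile (m : R) : 0 <= m -> u_tilde mu0 rho m = upot (profile mu0 rho) mu0 m.
Proof.
  intros Hm. unfold u_tilde, upot. destruct (Rle_dec m mu0) as [H | H].
  - rewrite I0_profile by lra. unfold I1.
    now rewrite (profile_RInt (fun t => (1 + 3 * t ^ 2) * arccot t - 3 * t)) by lra.
  - rewrite (I0_outside mu0 _ (weight_profile Hrho) profile_right m) by lra.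
    rewrite (I1_outside mu0 _ profile_right m) by lra. rewrite (I0_profile mu0) by lra. ring.
Qed.

Lemma v_tilde_profile (m : R) : 0 <= m -> v_tilde mu0 rho m = vpot (profile mu0 rho) mu0 m.
Proof.
  intros Hm. unfold v_tilde, vpot. destruct (Rle_dec m mu0) as [H | H].
  - rewrite I0_profile by lra. rewrite !I2_flip. unfold I1.
    rewrite (profile_RInt (fun t => (1 + 3 * t ^ 2) * arccot t - 3 * t)) by lra.
    now rewrite (profile_RInt (fun t => t)) by lra.
  - rewrite (I0_outside mu0 _ (weight_profile Hrho) profile_right m) by lra.
    rewrite (I1_outside mu0 _ profile_right m), (I2_outside mu0 _ profile_right m) by lra.
    rewrite (I0_profile mu0) by lra. ring.
Qed.

End Profile.

(** * Uniqueness *)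

Definition in_box (L : R) (p : R * R * R) : Prop :=
  let '(x, y, z) := p in Rabs x <= L /\ Rabs y <= L /\ Rabs z <= L.

(** If no maximum were attained, every point of the box would have a neighbourhood on which [F]
    stays below [F q] for some [q] in the box. For a finite subcover the best of these [q] would
    satisfy [F q < F q]. *)
Lemma box_max (F : R * R * R -> R) (L : R) : 0 <= L -> (forall p, continuous F p) ->
  exists p0, in_box L p0 /\ forall p, in_box L p -> F p <= F p0.
Proof.
  intros HL HF. apply NNPP. intros Hno.
  assert (Up : forall p, in_box L p -> exists q, in_box L q /\ F p < F q).
  { intros p Hp. apply NNPP. intros H. apply Hno. exists p. split; trivial.
    intros q Hq. apply Rnot_lt_le. intros Hlt. apply H. now exists q. }
  pose (pt := fun t : Compactness.Tn 3 R => (fst t, fst (snd t), fst (snd (snd t)))).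
  assert (Nb : forall t : Compactness.Tn 3 R, { e : posreal | in_box L (pt t) ->
    exists q, in_box L q /\ forall s, close_n 3 e s t -> F (pt s) < F q }).
  { intros t. apply ClassicalEpsilon.constructive_indefinite_description.
    destruct (classic (in_box L (pt t))) as [Ht | Ht]; [|exists (mkposreal 1 Rlt_0_1); tauto].
    destruct (Up _ Ht) as [q [Hq Hlt]].
    assert (Hp : 0 < F q - F (pt t)) by lra.
    destruct (proj1 (filterlim_locally F (F (pt t))) (HF (pt t)) (mkposreal _ Hp)) as [e He].
    exists e. intros _. exists q. split; trivial.
    destruct t as [x [y [z []]]]. intros [x' [y' [z' []]]] (Hx & Hy & Hz & _).
    assert (Hs := He (x', y', z') (conj (conj Hx Hy) Hz)).
    change (Rabs (F (x', y', z') - F (x, y, z)) < F q - F (x, y, z)) in Hs.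
    apply Rabs_def2 in Hs. unfold pt; simpl. lra. }
  apply (compactness_list 3 (- L, (- L, (- L, tt))) (L, (L, (L, tt))) (fun t => proj1_sig (Nb t))).
  intros [l Hl].
  assert (Bd : forall t, bounded_n 3 (- L, (- L, (- L, tt))) (L, (L, (L, tt))) t <-> in_box L (pt t)).
  { intros [x [y [z []]]]. unfold in_box, pt; simpl. rewrite !Rabs_le_between. tauto. }
  assert (Fin : forall l' : list (Compactness.Tn 3 R), exists q, in_box L q /\
     forall t, In t l' -> in_box L (pt t) ->
     forall s, close_n 3 (proj1_sig (Nb t)) s t -> F (pt s) < F q).
  { induction l' as [|t l' [q [Hq IH]]].
    - exists (0, 0, 0). split; [|now intros]. simpl. rewrite Rabs_R0. lra.
    - destruct (classic (in_box L (pt t))) as [Ht | Ht].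
      + destruct (proj2_sig (Nb t) Ht) as [q' [Hq' K]].
        destruct (Rle_dec (F q) (F q')) as [Hle | Hle].
        * exists q'. split; trivial. intros u [<- | Hu] Hbu s Hs; [now apply K|].
          eapply Rlt_le_trans; [now apply (IH u) | exact Hle].
        * exists q. split; trivial. intros u [<- | Hu] Hbu s Hs; [|now apply (IH u)].
          eapply Rlt_trans; [now apply K | lra].
      + exists q. split; trivial. intros u [<- | Hu] Hbu s Hs; [tauto | now apply (IH u)]. }
  destruct (Fin l) as [q [Hq K]]. destruct q as [[x y] z].
  assert (Hs : in_box L (pt (x, (y, (z, tt))))) by exact Hq.
  destruct (Hl (x, (y, (z, tt))) (proj2 (Bd _) Hs)) as [t [Ht [Hbt Hct]]].
  apply (Rlt_irrefl (F (x, y, z))). apply (K t Ht (proj1 (Bd t) Hbt) (x, (y, (z, tt))) Hct).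
Qed.

Lemma Derive_bound_lipschitz (f : R -> R) (a b M : R) :
  (forall t, Rmin a b <= t <= Rmax a b -> ex_derive f t /\ Rabs (Derive f t) <= M) ->
  Rabs (f b - f a) <= M * Rabs (b - a).
Proof.
  intros H. destruct (MVT_gen f a b (Derive f)) as [c [Hc E]].
  - intros t Ht. apply Derive_correct, H. lra.
  - intros t Ht. apply continuity_pt_filterlim. apply (ex_derive_continuous f), H, Ht.
  - rewrite E, Rabs_mult. apply Rmult_le_compat_r; [apply Rabs_pos | now apply H].
Qed.

(** Only partial derivatives are given. Their continuity bounds them near the point, and the mean
    value theorem is applied along three segments parallel to the axes. *)
Lemma is_C1_continuous (U : R * R * R -> R) : is_C1 U -> forall p, continuous U p.
Proof.
  intros [HD HC] [[x y] z]. destruct (HC (x, y, z)) as (Cx & Cy & Cz).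
  assert (Bnd : forall g : R * R * R -> R, continuous g (x, y, z) ->
    locally (x, y, z) (fun q => Rabs (g q) <= Rabs (g (x, y, z)) + 1)).
  { intros g Hg. generalize (proj1 (filterlim_locally g _) Hg (mkposreal 1 Rlt_0_1)).
    apply filter_imp. intros q Hq. change (Rabs (g q - g (x, y, z)) < 1) in Hq.
    replace (g q) with (g q - g (x, y, z) + g (x, y, z)) by ring.
    eapply Rle_trans; [apply Rabs_triang|]. lra. }
  set (M := Rabs (Defs.Dx U (x, y, z)) + Rabs (Dy U (x, y, z)) + Rabs (Dz U (x, y, z)) + 1).
  pose proof (Rabs_pos (Defs.Dx U (x, y, z))) as Px. pose proof (Rabs_pos (Dy U (x, y, z))) as Py.
  pose proof (Rabs_pos (Dz U (x, y, z))) as Pz.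
  destruct (filter_and _ _ (Bnd _ Cx) (filter_and _ _ (Bnd _ Cy) (Bnd _ Cz))) as [del K].
  apply filterlim_locally. intros eps.
  assert (HM : 0 < M) by (unfold M; lra).
  assert (He : 0 < Rmin del (eps / (3 * M))).
  { apply Rmin_pos; [apply cond_pos|]. apply Rdiv_lt_0_compat; [apply cond_pos | lra]. }
  exists (mkposreal _ He). intros [[x' y'] z'] [[Bx By] Bz].
  change (Rabs (x' - x) < Rmin del (eps / (3 * M))) in Bx.
  change (Rabs (y' - y) < Rmin del (eps / (3 * M))) in By.
  change (Rabs (z' - z) < Rmin del (eps / (3 * M))) in Bz.
  apply Rmin_Rgt_l in Bx, By, Bz.
  destruct Bx as [Bx1 Bx2], By as [By1 By2], Bz as [Bz1 Bz2].
  assert (Btw : forall a b t, Rabs (b - a) < del -> Rmin a b <= t <= Rmax a b -> Rabs (t - a) < del).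
  { intros a b t H. unfold Rmin, Rmax. destruct (Rle_dec a b); intros Ht;
    apply Rabs_def2 in H; apply Rabs_def1; lra. }
  assert (Self : forall a, Rabs (a - a) < del)
    by (intros a; rewrite Rminus_diag, Rabs_R0; apply cond_pos).
  assert (K' : forall a b c, Rabs (a - x) < del -> Rabs (b - y) < del -> Rabs (c - z) < del ->
    Rabs (Defs.Dx U (a, b, c)) <= M /\ Rabs (Dy U (a, b, c)) <= M /\ Rabs (Dz U (a, b, c)) <= M).
  { intros a b c Ha Hb Hc. destruct (K (a, b, c) (conj (conj Ha Hb) Hc)) as (K1 & K2 & K3).
    unfold M. repeat split; lra. }
  assert (E1 : Rabs (U (x', y', z') - U (x, y', z')) <= M * Rabs (x' - x)).
  { apply (Derive_bound_lipschitz (fun t => U (t, y', z'))). intros t Ht. split; [exact (proj1 (HD t y' z'))|].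
    apply (K' t y' z'); trivial. now apply (Btw x x'). }
  assert (E2 : Rabs (U (x, y', z') - U (x, y, z')) <= M * Rabs (y' - y)).
  { apply (Derive_bound_lipschitz (fun t => U (x, t, z'))). intros t Ht.
    split; [exact (proj1 (proj2 (HD x t z')))|].
    apply (K' x t z'); trivial. now apply (Btw y y'). }
  assert (E3 : Rabs (U (x, y, z') - U (x, y, z)) <= M * Rabs (z' - z)).
  { apply (Derive_bound_lipschitz (fun t => U (x, y, t))). intros t Ht.
    split; [exact (proj2 (proj2 (HD x y t)))|].
    apply (K' x y t); trivial. now apply (Btw z z'). }
  change (Rabs (U (x', y', z') - U (x, y, z)) < eps).
  replace (U (x', y', z') - U (x, y, z)) with ((U (x', y', z') - U (x, y', z'))
    + (U (x, y', z') - U (x, y, z')) + (U (x, y, z') - U (x, y, z))) by ring.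
  eapply Rle_lt_trans; [apply Rabs_triang|].
  eapply Rle_lt_trans; [apply Rplus_le_compat_r, Rabs_triang|].
  assert (Hm : M * (eps / (3 * M)) = eps / 3) by (field; lra).
  apply Rgt_lt in Bx2, By2, Bz2.
  apply Rmult_lt_compat_l with (r := M) in Bx2, By2, Bz2; trivial.
  pose proof (cond_pos eps). lra.
Qed.

(** * Symmetric second differences *)

Definition second_difference (F : R * R * R -> R) (p : R * R * R) (h : R) : R :=
  let '(x, y, z) := p in
  (F (x + h, y, z) + F (x - h, y, z) - 2 * F p)
  + (F (x, y + h, z) + F (x, y - h, z) - 2 * F p)
  + (F (x, y, z + h) + F (x, y, z - h) - 2 * F p).

(** The first-order terms at [h] and [- h] cancel. This is all that is known of a [C^1] function on
    a surface where its Laplacian may fail to exist. *)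
Lemma second_difference_little_o (f : R -> R) (x : R) : ex_derive f x ->
  forall eps, 0 < eps -> exists del, 0 < del /\ forall h, Rabs h < del ->
    Rabs (f (x + h) + f (x - h) - 2 * f x) <= eps * Rabs h.
Proof.
  intros [l Hl] eps He. destruct (is_derive_to_eps f x l Hl (eps / 2) ltac:(lra)) as [del [Hd K]].
  exists del. split; trivial. intros h Hh.
  pose proof (K h Hh) as K1. pose proof (K (- h) ltac:(now rewrite Rabs_Ropp)) as K2.
  rewrite Rabs_Ropp in K2.
  replace (f (x + h) + f (x - h) - 2 * f x) with
    ((f (x + h) - f x - l * h) + (f (x + - h) - f x - l * - h)) by (unfold Rminus; ring).
  eapply Rle_trans; [apply Rabs_triang|]. lra.
Qed.

(** The second derivative is given at [x] alone. The mean value theorem is therefore applied once,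
    to the symmetrised remainder [psi]; its derivative is [o(t)] because [Derive f] is
    differentiable at [x]. *)
Lemma second_difference_derive (f : R -> R) (x l : R) :
  (forall t, ex_derive f t) -> is_derive_n f 2 x l ->
  forall eps, 0 < eps -> exists del, 0 < del /\ forall h, Rabs h < del ->
    Rabs (f (x + h) + f (x - h) - 2 * f x - l * h ^ 2) <= eps * h ^ 2.
Proof.
  intros Hf Hl eps He.
  destruct (is_derive_to_eps (Derive f) x l Hl (eps / 2) ltac:(lra)) as [del [Hd K]].
  exists del. split; trivial. intros h Hh.
  set (psi := fun t => f (x + t) + f (x - t) - 2 * f x - l * t ^ 2).
  set (psi' := fun t => Derive f (x + t) - Derive f (x - t) - 2 * l * t).
  assert (D : forall t, is_derive psi t (psi' t)).
  { intros t. unfold psi, psi'. auto_derive; [repeat split; apply Hf|].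
    replace (x + - t) with (x - t) by ring.
    change (fun x0 : R => f x0) with f. ring. }
  destruct (MVT_gen psi 0 h psi') as [c [Hc E]].
  - intros; apply D.
  - intros t _. apply continuity_pt_filterlim, (is_derive_cont psi t (psi' t)), D.
  - assert (H0 : psi 0 = 0) by (unfold psi; rewrite Rplus_0_r, Rminus_0_r; ring).
    rewrite H0 in E. fold (psi h). replace (psi h) with (psi' c * h) by lra.
    assert (Hch : Rabs c <= Rabs h).
    { revert Hc. unfold Rmin, Rmax. destruct (Rle_dec 0 h); intros Hc;
      unfold Rabs; destruct (Rcase_abs c), (Rcase_abs h); lra. }
    pose proof (K c ltac:(lra)) as K1.
    pose proof (K (- c) ltac:(rewrite Rabs_Ropp; lra)) as K2. rewrite Rabs_Ropp in K2.
    rewrite Rabs_mult. rewrite <- (pow2_abs h).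
    replace (eps * Rabs h ^ 2) with (eps * Rabs h * Rabs h) by ring.
    apply Rmult_le_compat_r; [apply Rabs_pos|].
    replace (psi' c) with ((Derive f (x + c) - Derive f x - l * c)
      - (Derive f (x + - c) - Derive f x - l * - c)) by (unfold psi', Rminus; ring).
    unfold Rminus at 1. eapply Rle_trans; [apply Rabs_triang|]. rewrite Rabs_Ropp. nra.
Qed.

Lemma second_difference_C1 (U : R * R * R -> R) : is_C1 U -> forall p eps, 0 < eps ->
  exists del, 0 < del /\ forall h, Rabs h < del ->
    Rabs (second_difference U p h) <= eps * Rabs h.
Proof.
  intros [HD _] [[x y] z] eps He. destruct (HD x y z) as (Hx & Hy & Hz).
  destruct (second_difference_little_o (fun t : R => U (t, y, z)) x Hx (eps / 3) ltac:(lra)) as [d1 [Hd1 K1]].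
  destruct (second_difference_little_o (fun t : R => U (x, t, z)) y Hy (eps / 3) ltac:(lra)) as [d2 [Hd2 K2]].
  destruct (second_difference_little_o (fun t : R => U (x, y, t)) z Hz (eps / 3) ltac:(lra)) as [d3 [Hd3 K3]].
  exists (Rmin d1 (Rmin d2 d3)). split; [repeat apply Rmin_pos; trivial|].
  intros h Hh. apply Rmin_Rgt_l in Hh. destruct Hh as [H1 Hh].
  apply Rmin_Rgt_l in Hh. destruct Hh as [H2 H3].
  specialize (K1 h H1). specialize (K2 h H2). specialize (K3 h H3).
  cbv beta in K1, K2, K3.
  apply Rabs_le_between in K1, K2, K3. apply Rabs_le. unfold second_difference. lra.
Qed.

Lemma second_difference_laplacian (U : R * R * R -> R) (p : R * R * R) (l : R) :
  is_C1 U -> is_laplacian U p l -> forall eps, 0 < eps ->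
  exists del, 0 < del /\ forall h, Rabs h < del ->
    Rabs (second_difference U p h - l * h ^ 2) <= eps * h ^ 2.
Proof.
  intros [HD _] HL eps He. destruct p as [[x y] z].
  destruct HL as [a [b [c [Ha [Hb [Hc ->]]]]]].
  destruct (second_difference_derive (fun t : R => U (t, y, z)) x a
    (fun t => proj1 (HD t y z)) Ha (eps / 3) ltac:(lra))
    as [d1 [Hd1 K1]].
  destruct (second_difference_derive (fun t : R => U (x, t, z)) y b
    (fun t => proj1 (proj2 (HD x t z))) Hb (eps / 3) ltac:(lra))
    as [d2 [Hd2 K2]].
  destruct (second_difference_derive (fun t : R => U (x, y, t)) z c
    (fun t => proj2 (proj2 (HD x y t))) Hc (eps / 3) ltac:(lra))
    as [d3 [Hd3 K3]].
  exists (Rmin d1 (Rmin d2 d3)). split; [repeat apply Rmin_pos; trivial|].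
  intros h Hh. apply Rmin_Rgt_l in Hh. destruct Hh as [H1 Hh].
  apply Rmin_Rgt_l in Hh. destruct Hh as [H2 H3].
  specialize (K1 h H1). specialize (K2 h H2). specialize (K3 h H3).
  cbv beta in K1, K2, K3.
  apply Rabs_le_between in K1, K2, K3. apply Rabs_le. unfold second_difference. lra.
Qed.

(** Vanishes exactly on the spheroid [mu = m], when [m > 0]. *)
Definition spheroid_form (d m : R) (p : R * R * R) : R :=
  rsq p * m ^ 2 + zcoord p ^ 2 * (1 + m ^ 2) - d ^ 2 * m ^ 2 * (1 + m ^ 2).

(** A strictly subharmonic function with convex kinks along the plane [z = 0] and the
    listed spheroids: added to a [C^1] function it admits no maximum on a kink. *)
Fixpoint barrier (d : R) (L : list R) (p : R * R * R) : R :=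
  match L with
  | nil => rsq p + zcoord p ^ 2 + Rabs (zcoord p)
  | m :: L => (1 + 3 * m ^ 2) * (rsq p + zcoord p ^ 2) + Rabs (spheroid_form d m p)
              + barrier d L p
  end.

(** * The kinked barrier and the maximum principle *)

Section Barrier.
Variable d : R.

Lemma barrier_ge0 (L : list R) (p : R * R * R) : 0 <= barrier d L p.
Proof.
  pose proof (rsq_ge0 p) as Hr. assert (Hz : 0 <= zcoord p ^ 2) by nra.
  induction L as [|m L IH]; simpl barrier.
  - pose proof (Rabs_pos (zcoord p)). lra.
  - pose proof (Rabs_pos (spheroid_form d m p)).
    assert (0 <= (1 + 3 * m ^ 2) * (rsq p + zcoord p ^ 2)) by (apply Rmult_le_pos; nra). lra.
Qed.

Lemma continuous_Rabs_comp {T : UniformSpace} (f : T -> R) (x : T) :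
  continuous f x -> continuous (fun t => Rabs (f t)) x.
Proof. intros Hf. apply (continuous_comp f Rabs); [exact Hf | apply continuous_Rabs]. Qed.

Lemma barrier_continuous (L : list R) (p : R * R * R) : continuous (barrier d L) p.
Proof.
  assert (Hr := rsq_continuous p). assert (Hz := zcoord_continuous p).
  assert (Hz2 : continuous (fun p => zcoord p ^ 2) p) by now apply continuous_pow.
  induction L as [|m L IH].
  - apply continuous_Rplus; [now apply continuous_Rplus|]. now apply continuous_Rabs_comp.
  - apply continuous_Rplus; [|exact IH]. apply continuous_Rplus.
    + apply continuous_Rmult; [apply continuous_const | now apply continuous_Rplus].
    + apply continuous_Rabs_comp. unfold spheroid_form.
      apply continuous_Rminus; [|apply continuous_const].
      apply continuous_Rplus; apply continuous_Rmult; trivial; apply continuous_const.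
Qed.

(** [|F|] dominates both [F] and [- F] and equals one of them at [p], so its second difference is at
    least that of this one. *)
Lemma second_difference_Rabs (F : R * R * R -> R) (p : R * R * R) (h : R) :
  - Rabs (second_difference F p h) <= second_difference (fun q => Rabs (F q)) p h.
Proof.
  destruct p as [[x y] z]. unfold second_difference.
  pose proof (Rle_abs (F (x + h, y, z))). pose proof (Rle_abs (- F (x + h, y, z))).
  pose proof (Rle_abs (F (x - h, y, z))). pose proof (Rle_abs (- F (x - h, y, z))).
  pose proof (Rle_abs (F (x, y + h, z))). pose proof (Rle_abs (- F (x, y + h, z))).
  pose proof (Rle_abs (F (x, y - h, z))). pose proof (Rle_abs (- F (x, y - h, z))).
  pose proof (Rle_abs (F (x, y, z + h))). pose proof (Rle_abs (- F (x, y, z + h))).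
  pose proof (Rle_abs (F (x, y, z - h))). pose proof (Rle_abs (- F (x, y, z - h))).
  rewrite !Rabs_Ropp in *.
  match goal with |- - Rabs ?e <= _ => pose proof (Rle_abs e); pose proof (Rle_abs (- e)) end.
  rewrite Rabs_Ropp in *.
  destruct (Rcase_abs (F (x, y, z))) as [Hs | Hs];
    [rewrite (Rabs_left _ Hs) | rewrite (Rabs_right _ Hs)]; lra.
Qed.

Lemma second_difference_form (m h : R) (p : R * R * R) :
  second_difference (spheroid_form d m) p h = 2 * (1 + 3 * m ^ 2) * h ^ 2.
Proof. destruct p as [[x y] z]. unfold second_difference, spheroid_form, rsq, zcoord; cbn [snd]. ring. Qed.

Lemma second_difference_barrier_cons (m h : R) (L : list R) (p : R * R * R) :
  second_difference (barrier d (m :: L)) p h =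
  (1 + 3 * m ^ 2) * (6 * h ^ 2) + second_difference (fun q => Rabs (spheroid_form d m q)) p h
  + second_difference (barrier d L) p h.
Proof.
  destruct p as [[x y] z]. unfold second_difference, rsq, zcoord; simpl barrier.
  unfold rsq, zcoord; cbn [snd]. ring.
Qed.

Lemma second_difference_barrier_nil (h : R) (p : R * R * R) :
  second_difference (barrier d nil) p h =
  6 * h ^ 2 + (Rabs (zcoord p + h) + Rabs (zcoord p - h) - 2 * Rabs (zcoord p)).
Proof.
  destruct p as [[x y] z]. unfold second_difference; simpl barrier.
  unfold rsq, zcoord; cbn [snd]. ring.
Qed.

(** The origin of the coefficient [1 + 3 m^2] in [barrier]: the quadratic term contributes
    [6 (1 + 3 m^2) h^2], and the absolute value loses at most [2 (1 + 3 m^2) h^2]. *)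
Lemma second_difference_barrier_mono (m h : R) (L : list R) (p : R * R * R) :
  second_difference (barrier d L) p h <= second_difference (barrier d (m :: L)) p h.
Proof.
  rewrite second_difference_barrier_cons.
  pose proof (second_difference_Rabs (spheroid_form d m) p h) as H.
  rewrite second_difference_form in H.
  assert (0 <= (1 + 3 * m ^ 2) * h ^ 2) by (apply Rmult_le_pos; nra).
  rewrite Rabs_pos_eq in H by lra. lra.
Qed.

Lemma second_difference_barrier (h : R) (L : list R) (p : R * R * R) :
  6 * h ^ 2 <= second_difference (barrier d L) p h.
Proof.
  induction L as [|m L IH].
  - rewrite second_difference_barrier_nil.
    pose proof (Rabs_triang (zcoord p + h) (zcoord p - h)) as T.
    replace (zcoord p + h + (zcoord p - h)) with (2 * zcoord p) in T by ring.
    rewrite Rabs_mult, (Rabs_pos_eq 2) in T by lra. lra.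
  - eapply Rle_trans; [exact IH | apply second_difference_barrier_mono].
Qed.

Lemma second_difference_barrier_plane (h : R) (L : list R) (p : R * R * R) :
  zcoord p = 0 -> 2 * Rabs h <= second_difference (barrier d L) p h.
Proof.
  intros Hz. induction L as [|m L IH].
  - rewrite second_difference_barrier_nil, Hz, Rplus_0_l, Rminus_0_l, Rabs_Ropp, Rabs_R0. nra.
  - eapply Rle_trans; [exact IH | apply second_difference_barrier_mono].
Qed.

(** On the spheroid the two values in the [z] direction have absolute values summing to at least
    their difference, [4 (1 + m^2) |z h|]: first order in [h] as soon as [z] is nonzero. *)
Lemma second_difference_barrier_spheroid (m h : R) (L : list R) (p : R * R * R) :
  In m L -> spheroid_form d m p = 0 ->
  4 * Rabs (zcoord p) * Rabs h <= second_difference (barrier d L) p h.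
Proof.
  intros Hin H0. induction L as [|m' L IH]; [destruct Hin|].
  destruct Hin as [-> | Hin];
    [|eapply Rle_trans; [now apply IH | apply second_difference_barrier_mono]].
  rewrite second_difference_barrier_cons.
  pose proof (second_difference_barrier h L p) as Hb.
  assert (Hm : 0 <= (1 + 3 * m ^ 2) * (6 * h ^ 2)) by (apply Rmult_le_pos; nra).
  assert (Hh : 0 <= h ^ 2) by nra.
  destruct p as [[x y] z]. unfold second_difference at 1. rewrite H0, Rabs_R0.
  pose proof (Rabs_pos (spheroid_form d m (x + h, y, z))).
  pose proof (Rabs_pos (spheroid_form d m (x - h, y, z))).
  pose proof (Rabs_pos (spheroid_form d m (x, y + h, z))).
  pose proof (Rabs_pos (spheroid_form d m (x, y - h, z))).
  pose proof (Rabs_triang (spheroid_form d m (x, y, z + h)) (- spheroid_form d m (x, y, z - h))) as T.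
  rewrite Rabs_Ropp in T.
  replace (spheroid_form d m (x, y, z + h) + - spheroid_form d m (x, y, z - h))
    with (4 * (1 + m ^ 2) * (z * h)) in T
    by (unfold spheroid_form, rsq, zcoord; cbn [snd]; ring).
  rewrite !Rabs_mult, (Rabs_pos_eq 4), (Rabs_pos_eq (1 + m ^ 2)) in T by nra.
  unfold zcoord; cbn [snd].
  assert (0 <= m ^ 2 * (Rabs z * Rabs h)).
  { apply Rmult_le_pos; [nra|]. apply Rmult_le_pos; apply Rabs_pos. }
  lra.
Qed.

Lemma in_box_far (L A : R) (x y z : R) : A < L -> in_box L (x, y, z) ->
  (A < sqrt (rsq (x, y, z) + zcoord (x, y, z) ^ 2)) \/
  (Rabs x < L /\ Rabs y < L /\ Rabs z < L).
Proof.
  intros HA (Hx & Hy & Hz). unfold rsq, zcoord; cbn [snd].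
  assert (S : forall t, t ^ 2 <= x ^ 2 + y ^ 2 + z ^ 2 -> Rabs t = L ->
    A < sqrt (x ^ 2 + y ^ 2 + z ^ 2)).
  { intros t Ht E. apply Rlt_le_trans with (Rabs t); [lra|].
    rewrite <- sqrt_Rsqr_abs. apply sqrt_le_1_alt. unfold Rsqr. lra. }
  destruct (Req_dec (Rabs x) L) as [E | E1]; [left; apply (S x); trivial; nra|].
  destruct (Req_dec (Rabs y) L) as [E | E2]; [left; apply (S y); trivial; nra|].
  destruct (Req_dec (Rabs z) L) as [E | E3]; [left; apply (S z); trivial; nra|].
  right. lra.
Qed.

Lemma maximum_principle (W : R * R * R -> R) (L : list R) :
  (forall p, continuous W p) -> vanishes_at_infinity W ->
  (forall p eps, 0 < eps -> exists del, 0 < del /\ forall h, Rabs h < del ->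
    Rabs (second_difference W p h) <= eps * Rabs h) ->
  (forall p, zcoord p <> 0 -> (forall m, In m L -> spheroid_form d m p <> 0) ->
    forall eps, 0 < eps -> exists del, 0 < del /\ forall h, Rabs h < del ->
    Rabs (second_difference W p h) <= eps * h ^ 2) ->
  forall p, W p <= 0.
Proof.
  intros HC Hinf H1 H2 p1. apply Rnot_lt_le. intros Hpos.
  set (eta := W p1 / 2). assert (Heta : 0 < eta) by (unfold eta; lra).
  destruct (Hinf eta Heta) as [A HA].
  destruct p1 as [[x1 y1] z1] eqn:Ep1.
  (* The box contains the point where [W] is positive, and its faces lie beyond the distance [A]. *)
  set (B := Rabs A + Rabs x1 + Rabs y1 + Rabs z1 + 1).
  pose proof (Rle_abs A) as PA. pose proof (Rabs_pos A) as PA0.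
  pose proof (Rabs_pos x1) as Px. pose proof (Rabs_pos y1) as Py. pose proof (Rabs_pos z1) as Pz.
  assert (HB : 0 <= B) by (unfold B; lra).
  destruct (box_max (barrier d L) B HB (barrier_continuous L)) as [pN [_ HN]].
  set (N := barrier d L pN) in *.
  assert (HN0 : 0 <= N) by apply barrier_ge0.
  (* The perturbation stays below [eta] throughout the box; [N + 1] keeps the denominator
     positive. *)
  set (eps := eta / (N + 1)).
  assert (Heps : 0 < eps) by (apply Rdiv_lt_0_compat; lra).
  assert (HepsN : eps * N < eta).
  { replace eta with (eps * (N + 1)) by (unfold eps; field; lra). lra. }
  set (V := fun p => W p + eps * barrier d L p).
  destruct (box_max V B HB) as [p0 [Hp0 Hmax]].
  { intros p. apply continuous_Rplus; trivial.
    apply continuous_Rmult; [apply continuous_const | apply barrier_continuous]. }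
  assert (Hval : 2 * eta <= V p0).
  { eapply Rle_trans; [|apply (Hmax (x1, y1, z1))].
    - unfold V, eta. pose proof (barrier_ge0 L (x1, y1, z1)). nra.
    - unfold in_box, B. lra. }
  destruct p0 as [[x y] z].
  destruct (in_box_far B A x y z ltac:(unfold B; lra) Hp0) as [Hfar | (Bx & By & Bz)].
  (* Beyond distance [A], [V] is below [eta + eta], against [2 * eta <= V p0]; the maximum is
     therefore interior to the box. *)
  { apply HA in Hfar. apply Rabs_def2 in Hfar. specialize (HN _ Hp0). unfold V in Hval. nra. }
  set (r := Rmin (B - Rabs x) (Rmin (B - Rabs y) (B - Rabs z))).
  assert (Hr : 0 < r) by (unfold r; repeat apply Rmin_pos; lra).
  assert (SV : forall h, 0 < h < r ->
    second_difference W (x, y, z) h + eps * second_difference (barrier d L) (x, y, z) h <= 0).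
  { intros h Hh.
    assert (R1 : r <= B - Rabs x) by apply Rmin_l.
    assert (R2 : r <= B - Rabs y) by (eapply Rle_trans; [apply Rmin_r | apply Rmin_l]).
    assert (R3 : r <= B - Rabs z) by (eapply Rle_trans; [apply Rmin_r | apply Rmin_r]).
    assert (In1 : forall t, r <= B - Rabs t -> Rabs (t + h) <= B /\ Rabs (t - h) <= B).
    { intros t Ht. pose proof (Rle_abs t). pose proof (Rle_abs (- t)) as T. rewrite Rabs_Ropp in T.
      split; apply Rabs_le; lra. }
    destruct (In1 x R1), (In1 y R2), (In1 z R3).
    replace (second_difference W (x, y, z) h + eps * second_difference (barrier d L) (x, y, z) h)
      with (second_difference V (x, y, z) h) by (unfold second_difference, V; ring).
    unfold second_difference.
    pose proof (Hmax (x + h, y, z)) as M1. pose proof (Hmax (x - h, y, z)) as M2.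
    pose proof (Hmax (x, y + h, z)) as M3. pose proof (Hmax (x, y - h, z)) as M4.
    pose proof (Hmax (x, y, z + h)) as M5. pose proof (Hmax (x, y, z - h)) as M6.
    unfold in_box in *. lra. }
  assert (Kink : forall c, 0 < c ->
    (forall h, c * Rabs h <= second_difference (barrier d L) (x, y, z) h) -> False).
  (* The kink contributes at least [eps * c * h], and [W] can offset only half of it. *)
  { intros c Hc Hk. destruct (H1 (x, y, z) (eps * c / 2)) as [del [Hdel K]].
    { apply Rdiv_lt_0_compat; [|lra]. now apply Rmult_lt_0_compat. }
    set (h := Rmin r del / 2).
    assert (Hmin : 0 < Rmin r del) by now apply Rmin_pos.
    pose proof (Rmin_l r del). pose proof (Rmin_r r del).
    assert (Hh : 0 < h) by (unfold h; lra).
    specialize (SV h ltac:(unfold h; lra)). specialize (Hk h).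
    specialize (K h ltac:(rewrite Rabs_pos_eq; unfold h; lra)).
    rewrite (Rabs_pos_eq h) in * by lra. apply Rabs_le_between in K.
    apply Rmult_le_compat_l with (r := eps) in Hk; [|lra].
    assert (0 < eps * c * h) 
      by (apply Rmult_lt_0_compat; [apply Rmult_lt_0_compat|]; trivial).
    lra. }
  destruct (Req_dec z 0) as [Hz | Hz].
  { apply (Kink 2); [lra|]. intros h. now apply second_difference_barrier_plane. }
  destruct (classic (exists m, In m L /\ spheroid_form d m (x, y, z) = 0)) as [[m [Hm E]] | Hno].
  { apply (Kink (4 * Rabs z)); [pose proof (Rabs_pos_lt z Hz); lra|].
    intros h. now apply (second_difference_barrier_spheroid m h L (x, y, z)). }
  (* Off the kinks the barrier contributes [6 * eps * h^2], against at most [eps * h^2] from [W]. *)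
  destruct (H2 (x, y, z) Hz) with (eps := eps) as [del [Hdel K]]; trivial.
  { intros m Hm E. apply Hno. now exists m. }
  set (h := Rmin r del / 2).
  assert (Hmin : 0 < Rmin r del) by now apply Rmin_pos.
  pose proof (Rmin_l r del). pose proof (Rmin_r r del).
  assert (Hh : 0 < h) by (unfold h; lra).
  specialize (SV h ltac:(unfold h; lra)).
  specialize (K h ltac:(rewrite Rabs_pos_eq; unfold h; lra)).
  pose proof (second_difference_barrier h L (x, y, z)) as Hb.
  apply Rabs_le_between in K. apply Rmult_le_compat_l with (r := eps) in Hb; [|lra].
  assert (0 < eps * h ^ 2) by (apply Rmult_lt_0_compat; nra). lra.
Qed.

Lemma gravitational_potential_le (G : R) (f U V : R * R * R -> R) (L : list R) :
  (forall p, zcoord p <> 0 -> (forall m, In m L -> spheroid_form d m p <> 0) -> continuous f p) ->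
  is_gravitational_potential G f U -> is_gravitational_potential G f V ->
  forall p, U p <= V p.
Proof.
  intros Hf (UC & Uinf & Ulap) (VC & Vinf & Vlap) p.
  cut (U p - V p <= 0); [lra|].
  assert (Sd : forall p h, second_difference (fun p => U p - V p) p h =
    second_difference U p h - second_difference V p h).
  { intros [[x y] z] h. unfold second_difference. ring. }
  revert p. apply (maximum_principle (fun p => U p - V p) L).
  - intros p. apply continuous_Rminus; now apply is_C1_continuous.
  - intros eps He. destruct (Uinf (eps / 2) ltac:(lra)) as [A KA].
    destruct (Vinf (eps / 2) ltac:(lra)) as [B KB].
    exists (Rmax A B). intros p Hp. pose proof (Rmax_l A B). pose proof (Rmax_r A B).
    specialize (KA p ltac:(lra)). specialize (KB p ltac:(lra)).
    apply Rabs_def2 in KA, KB. apply Rabs_def1; lra.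
  - intros p eps He.
    destruct (second_difference_C1 U UC p (eps / 2) ltac:(lra)) as [d1 [Hd1 K1]].
    destruct (second_difference_C1 V VC p (eps / 2) ltac:(lra)) as [d2 [Hd2 K2]].
    exists (Rmin d1 d2). split; [now apply Rmin_pos|]. intros h Hh.
    apply Rmin_Rgt_l in Hh. destruct Hh as [h1 h2]. specialize (K1 h h1). specialize (K2 h h2).
    rewrite Sd. apply Rabs_le_between in K1, K2. apply Rabs_le. lra.
  - intros p Hz Hm eps He. specialize (Hf p Hz Hm).
    destruct (second_difference_laplacian U p _ UC (Ulap p Hf) (eps / 2) ltac:(lra)) as [d1 [Hd1 K1]].
    destruct (second_difference_laplacian V p _ VC (Vlap p Hf) (eps / 2) ltac:(lra)) as [d2 [Hd2 K2]].
    exists (Rmin d1 d2). split; [now apply Rmin_pos|]. intros h Hh.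
    apply Rmin_Rgt_l in Hh. destruct Hh as [h1 h2]. specialize (K1 h h1). specialize (K2 h h2).
    rewrite Sd. apply Rabs_le_between in K1, K2. apply Rabs_le. lra.
Qed.

End Barrier.

Theorem proposition1 :
  forall (d mu0 G : R) (rho : R -> R) (mu : R * R * R -> R),
    0 < d -> 0 < mu0 -> 0 < G ->
    admissible_density mu0 rho ->
    is_spheroidal_coordinate d mu ->
    let k := 4 * PI * G in
    let U0 := fun p : R * R * R =>
      k / 2 * (1 / 2 * (rsq p * u_tilde mu0 rho (mu p) / (1 + mu p ^ 2))
               + d ^ 2 * v_tilde mu0 rho (mu p)) in
    is_gravitational_potential G (density_field mu0 rho mu) U0 /\
    (forall U : R * R * R -> R,
       is_gravitational_potential G (density_field mu0 rho mu) U ->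
       forall p, U p = U0 p).
Proof.
  intros d mu0 G rho mu Hd Hmu0 _ Hrho Hmu k U0.
  pose proof (spheroidal_coordinate_eq d Hd mu Hmu) as Emu.
  set (P := profile mu0 rho).
  assert (Hpos : forall p, 0 <= mu p) by (intros p; rewrite Emu; apply conf_m_ge0).
  assert (Ef : density_field mu0 rho mu = fun p => P (spheroidal_mu d p)).
  { apply functional_extensionality. intros p.
    rewrite density_field_profile by trivial. now rewrite Emu. }
  assert (EU : U0 = fun p => 4 * PI * G * potential3 d mu0 P p).
  { apply functional_extensionality. intros p. unfold U0, k.
    rewrite u_tilde_profile, v_tilde_profile by trivial. rewrite Emu.
    unfold potential3, potential. fold P. field. nra. }
  assert (H0 : is_gravitational_potential G (density_field mu0 rho mu) U0).
  { rewrite Ef, EU. apply potential3_gravitational; trivial.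
    - now apply weight_profile.
    - now apply profile_right.
    - now apply profile_left. }
  split; trivial. intros U HU.
  destruct (profile_discontinuities mu0 rho Hmu0 Hrho) as [L HL].
  (* By the quadratic equation a point is a zero of [spheroid_form] at its own level [mu p], so
     avoiding the listed spheroids keeps [mu p] out of [L]. *)
  assert (Cf : forall p, zcoord p <> 0 -> (forall m, In m L -> spheroid_form d m p <> 0) ->
    continuous (density_field mu0 rho mu) p).
  { intros p Hz Hm. rewrite Ef.
    apply (continuous_comp (spheroidal_mu d)); [now apply spheroidal_mu_continuous|].
    assert (Hb : 0 <= zcoord p ^ 2) by nra.
    apply HL; [apply conf_m_pos; trivial; left; nra|].
    intros Hin. apply (Hm _ Hin). unfold spheroid_form, spheroidal_mu.
    rewrite conf_m_sqr by trivial.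
    pose proof (conf_s_eq d Hd (rsq p) (zcoord p ^ 2) Hb). lra. }
  intros p. apply Rle_antisym;
    now apply (gravitational_potential_le d G (density_field mu0 rho mu) _ _ L).
Qed.
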